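(* Each $\mathrm{Lod}_\infty$ algebra is $\mathrm{Lod}_\infty$ isomorphic to the direct sum of a minimal $\mathrm{Lod}_\infty$ algebra and a contractible $\mathrm{Lod}_\infty$ algebra.
   Context: Vector spaces are over a field $\mathbb{K}$ of characteristic $0$ and are $\mathbb{Z}^n$-graded; $\langle\alpha,\beta\rangle=\sum_i\alpha_i\beta_i$; a homogeneous vector or map and its degree/weight are denoted by the same symbol; $e_1=(1,0,\ldots,0)\in\mathbb{Z}^n$. Tensor coalgebra. For a graded space $W$, $T(W)=\bigoplus_{p\ge1}W^{\otimes p}$, $\mathbb{Z}^n$-graded by total degree, with coproduct $\Delta(w_1\otimes\ldots\otimes w_p)=\sum_{I\cup J=N^{(p-1)},\,I\ne\emptyset}\varepsilon_W(I;J)W_I\bigotimes W_J\otimes w_p$. Here $N^{(p)}=(1,\ldots,p)$, $I,J$ are disjoint naturally ordered subsets with the given union, $W_I=w_{i_1}\otimes\ldots\otimes w_{i_{|I|}}$, and $\varepsilon_W(I;J)$ is the Koszul sign of the rearrangement of $(W_I,W_J)$ into increasing index order. Tensor products of maps: $(f\otimes g)(v_1\otimes v_2)=(-1)^{\langle g,v_1\rangle}f(v_1)\otimes g(v_2)$. A weight $Q$ coderivation is a weight $Q$ linear map with $\Delta Q=(Q\otimes\mathrm{id}+\mathrm{id}\otimes Q)\Delta$; a codifferential is a coderivation with $Q^2=0$. A cohomomorphism $\mathcal{F}:(T(W),\Delta)\to(T(W'),\Delta)$ is a weight $0$ linear map with $\Delta\mathcal{F}=(\mathcal{F}\otimes\mathcal{F})\Delta$.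 Coderivations and cohomomorphisms are uniquely determined by their corestrictions (restriction to $W^{\otimes p}$ followed by projection onto $W$, resp. $W'$). Desuspension. $\downarrow V$ is $V$ with grading $(\downarrow V)^\alpha=V^{\alpha+e_1}$; $\downarrow:V\to\downarrow V$ has weight $-e_1$ and inverse $\uparrow$; $\downarrow^{\otimes p}=\downarrow\otimes\ldots\otimes\downarrow$. A $\mathrm{Lod}_\infty$ algebra is a graded space $V$ with a codifferential $Q$ of weight $e_1$ on $(T(\downarrow V),\Delta)$. It is represented by the sequence $\pi=(\pi_1,\pi_2,\ldots)$ of multilinear structure maps $\pi_p=\uparrow\circ Q_p\circ\downarrow^{\otimes p}:V^{\times p}\to V$ of weight $(2-p)e_1$; in particular $\pi_1^2=0$. A $\mathrm{Lod}_\infty$ morphism from $(V,Q)$ to $(V',Q')$ is a cohomomorphism $\mathcal{F}:T(\downarrow V)\to T(\downarrow V')$ with $Q'\mathcal{F}=\mathcal{F}Q$. It is represented by the sequence $f=(f_1,f_2,\ldots)$, $f_p=\uparrow\circ\mathcal{F}_p\circ\downarrow^{\otimes p}:V^{\times p}\to V'$ of weight $(1-p)e_1$. It is a $\mathrm{Lod}_\infty$ isomorphism if $f_1:V\to V'$ is an isomorphism. The direct sum of $\mathrm{Lod}_\infty$ algebras $(V,\pi)$, $(V',\pi')$ is $(V\oplus V',\pi\oplus\pi')$ with $(\pi\oplus\pi')_p(v_1+v'_1,\ldots,v_p+v'_p)=\pi_p(v_1,\ldots,v_p)+\pi'_p(v'_1,\ldots,v'_p)$. A $\mathrm{Lod}_\infty$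 algebra $(V,\pi)$ is minimal if $\pi_1=0$; it is contractible if $\pi_p=0$ for $p\ge2$ and $H(V,\pi_1)=\ker\pi_1/\mathrm{im}\,\pi_1=0$. *)

(* Defs.v *)
From HB Require Import structures.
From mathcomp Require Import all_boot all_order all_algebra.
From mathcomp Require Import boolp.
From mathcomp Require Import freeg.

Set Implicit Arguments.
Unset Strict Implicit.
Unset Printing Implicit Defensive.

Import GRing.Theory.
Import Quotient.

Local Open Scope ring_scope.
Local Open Scope quotient_scope.

(* freequot R is the vector space on the generators X subject to the relations
   r = 0 for R r. *)
Section FreeQuotient.
Variables (K : fieldType) (X : choiceType) (R : {freeg X / K} -> Prop).

Definition relspan : {freeg X / K} -> bool := fun x =>
  `[< exists s : seq (K * {freeg X / K}),
        (forall c, c \in s -> R c.2) /\ x = \sum_(c <- s) c.1 *: c.2 >].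

Lemma relspan_lin k x y : relspan x -> relspan y -> relspan (k *: x + y).
Proof.
move=> /asboolP[s [Rs ->]] /asboolP[t [Rt ->]]; apply/asboolP.
exists ([seq (k * c.1, c.2) | c <- s] ++ t); split=> [c|].
  by rewrite mem_cat => /orP[/mapP[d ds ->] /=|]; [apply: Rs|apply: Rt].
rewrite big_cat big_map /= scaler_sumr; congr (_ + _).
by apply: eq_bigr => c _; rewrite scalerA.
Qed.

Lemma relspan_rel x : R x -> relspan x.
Proof.
move=> Rx; apply/asboolP; exists [:: (1, x)].
by split=> [c /[!inE]/eqP->//|]; rewrite big_seq1 scale1r.
Qed.

Lemma relspan_zmod : zmod_closed relspan.
Proof.
split=> [|x y Rx Ry]; first by apply/asboolP; exists [::]; rewrite big_nil.
by rewrite addrC -scaleN1r; apply: relspan_lin.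
Qed.

Definition relspanZ : zmodClosed {freeg X / K} := 
  HB.pack relspan (GRing.isZmodClosed.Build {freeg X / K} relspan relspan_zmod).

Definition freequot := {quot relspanZ}.
HB.instance Definition _ := GRing.Zmodule.on freequot.

Definition fqpi (x : {freeg X / K}) : freequot := \pi_{quot relspanZ} x.
Definition fqgen (x : X) : freequot := fqpi << x >>.
Definition fqscale (k : K) (x : freequot) : freequot := fqpi (k *: repr x).

Lemma fqpi_eq x y : relspan (x - y) -> fqpi x = fqpi y.
Proof. by move=> xy; apply/eqP; rewrite -idealrBE. Qed.

Lemma fqpi_inv x y : fqpi x = fqpi y -> relspan (x - y).
Proof. by move=> /eqP; rewrite -idealrBE. Qed.

Lemma fqpiD x y : fqpi (x + y) = fqpi x + fqpi y.
Proof. exact: raddfD. Qed.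

Lemma fqpiK (x : freequot) : fqpi (repr x) = x.
Proof. exact: reprK. Qed.

Lemma fqpiZ k x : fqpi (k *: x) = fqscale k (fqpi x).
Proof.
apply: fqpi_eq; rewrite -scalerBr -[_ *: _]addr0.
apply: relspan_lin; last by case: relspan_zmod.
by apply: fqpi_inv; rewrite fqpiK.
Qed.

Lemma fqscaleA a b v : fqscale a (fqscale b v) = fqscale (a * b) v.
Proof. by rewrite -[v]fqpiK -!fqpiZ scalerA. Qed.
Lemma fqscale1 : left_id 1 fqscale.
Proof. by move=> v; rewrite -[v]fqpiK -!fqpiZ scale1r. Qed.
Lemma fqscaleDr : right_distributive fqscale +%R.
Proof. by move=> a u v; rewrite -[u]fqpiK -[v]fqpiK -fqpiD -!fqpiZ scalerDr fqpiD. Qed.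
Lemma fqscaleDl v : {morph fqscale^~ v : a b / a + b}.
Proof. by move=> a b /=; rewrite -[v]fqpiK -!fqpiZ scalerDl fqpiD. Qed.

HB.instance Definition _ := GRing.Zmodule_isLmodule.Build K freequot
  fqscaleA fqscale1 fqscaleDr fqscaleDl.

Lemma fqpi_linear : linear fqpi.
Proof. by move=> k x y; rewrite fqpiD fqpiZ. Qed.
HB.instance Definition _ := GRing.isLinear.Build K {freeg X / K} freequot _ fqpi fqpi_linear.

Lemma fqgen_ind (P : freequot -> Prop) :
  P 0 -> (forall k x y, P x -> P y -> P (k *: x + y)) ->
  (forall x, P (fqgen x)) -> forall x, P x.
Proof.
move=> P0 Plin Pgen x; rewrite -[x]fqpiK -[repr x]freeg_sumE raddf_sum /=.
elim: (dom _) => [|y s IHs]; first by rewrite big_nil.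
rewrite big_cons; set c := coeff y _.
suff -> : << c *g y >> = c *: << y >> :> {freeg X / K}.
  by rewrite linearZ; apply: Plin; [apply: Pgen|].
by apply/eqP/freeg_eqP => z; rewrite coeffZ !coeffU mul1r.
Qed.

Section Lift.
Variables (U : lmodType K) (phi : X -> U).

Lemma fglift_linear : linear (fglift phi : {freeg X / K} -> U).
Proof.
have addf : {morph fglift phi : x y / x - y} by exact: lift_is_additive.
have f0 : fglift phi 0 = 0 by rewrite -(subrr 0) addf subrr.
have fN y : fglift phi (- y) = - fglift phi y by rewrite -sub0r addf f0 sub0r.
have fD x y : fglift phi (x + y) = fglift phi x + fglift phi y.
  by rewrite -{1}[y]opprK addf fN opprK.
have fS (s : seq X) (F : X -> {freeg X / K}) :
    fglift phi (\sum_(z <- s) F z) = \sum_(z <- s) fglift phi (F z).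
  by elim: s => [|z s IHs]; rewrite ?big_nil // !big_cons fD IHs.
move=> k x y; rewrite fD; congr (_ + _).
have -> : k *: x = \sum_(z <- dom x) << k * coeff z x *g z >> by [].
rewrite (fS _ (fun z => << k * coeff z x *g z >>)) -{3}[x]freeg_sumE.
rewrite (fS _ (fun z => << coeff z x *g z >>)) scaler_sumr.
by apply: eq_bigr => z _; rewrite !liftU scalerA.
Qed.
Let fgl : {linear {freeg X / K} -> U} :=
  HB.pack (fglift phi : {freeg X / K} -> U)
    (GRing.isLinear.Build K {freeg X / K} U _ (fglift phi) fglift_linear).

Definition fqlift (x : freequot) : U := fglift phi (repr x).

Hypothesis phiR : forall x, R x -> fglift phi x = 0.

Lemma fqlift_pi x : fqlift (fqpi x) = fglift phi x.
Proof.
apply/eqP; rewrite -subr_eq0; apply/eqP.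
have /asboolP[s [Rs e]] : relspan (repr (fqpi x) - x).
  by apply: fqpi_inv; rewrite fqpiK.
rewrite -[LHS](raddfB fgl) e [LHS](raddf_sum fgl) big_seq big1 // => c cs.
by rewrite [LHS](linearZ_LR fgl c.1) /= phiR ?scaler0 //; apply: Rs.
Qed.

Lemma fqlift_gen x : fqlift (fqgen x) = phi x.
Proof. by rewrite fqlift_pi liftU scale1r. Qed.

Lemma fqlift_linear : linear fqlift.
Proof.
by move=> k x y; rewrite -[x]fqpiK -[y]fqpiK -linearP !fqlift_pi fglift_linear.
Qed.
End Lift.
End FreeQuotient.

Section TensorWords.
Variables (K : fieldType) (W : lmodType K).

(* The empty word is killed, so that only the tensor powers with p >= 1 remain. *)
Inductive wordrel : {freeg (seq W) / K} -> Prop :=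
| wordrel_nil : wordrel << [::] >>
| wordrel_lin k a b u v : wordrel
    (<< u ++ (k *: a + b) :: v >> - (k *: << u ++ a :: v >> + << u ++ b :: v >>)).

(* The direct sum of the tensor powers W^{(x) p}, p >= 1. *)
Definition tmod : lmodType K := freequot wordrel.

(* word [:: w_1; ...; w_p] is w_1 (x) ... (x) w_p. *)
Definition word (w : seq W) : tmod := fqgen wordrel w.

Definition multilinear (U : lmodType K) (phi : seq W -> U) : Prop :=
  forall k a b u v,
    phi (u ++ (k *: a + b) :: v) = k *: phi (u ++ a :: v) + phi (u ++ b :: v).

Lemma word_nil : word [::] = 0.
Proof.
rewrite -[RHS](linear0 (fqpi wordrel)); apply/fqpi_eq/relspan_rel.
by rewrite subr0; apply: wordrel_nil.
Qed.

Lemma word_multilinear : multilinear word.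
Proof.
move=> k a b u v; rewrite /word /fqgen -linearP.
by apply/fqpi_eq/relspan_rel/wordrel_lin.
Qed.

Lemma word_ind (P : tmod -> Prop) :
  P 0 -> (forall k x y, P x -> P y -> P (k *: x + y)) ->
  (forall w, P (word w)) -> forall x, P x.
Proof. exact: fqgen_ind. Qed.

Section Lift.
Variables (U : lmodType K) (phi : seq W -> U).
Hypotheses (phi0 : phi [::] = 0) (phiM : multilinear phi).

Lemma wordrel_lift x : wordrel x -> fglift phi x = 0.
Proof.
case=> [|k a b u v]; first by rewrite liftU scale1r.
rewrite addrC -scaleN1r !fglift_linear !liftU !scale1r phiM.
by rewrite scaleN1r addNr.
Qed.

Definition tlift : {linear tmod -> U} :=
  HB.pack (@fqlift K (seq W) wordrel U phi : tmod -> U)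
    (GRing.isLinear.Build K tmod U _ (@fqlift K (seq W) wordrel U phi)
       (fqlift_linear wordrel_lift)).

Lemma tliftE w : tlift (word w) = phi w.
Proof. exact: (fqlift_gen wordrel_lift). Qed.
End Lift.

Definition letter (w : seq W) : W := if w is [:: x] then x else 0.

Lemma letter_multilinear : multilinear letter.
Proof.
by move=> k a b [|x [|y u]] [|z v] //=; rewrite scaler0 addr0.
Qed.

Definition tproj : {linear tmod -> W} := tlift (erefl (letter [::])) letter_multilinear.

End TensorWords.

Section Tensor.
Variables (K : fieldType) (A B : lmodType K).

Inductive tensrel : {freeg (A * B)%type / K} -> Prop :=
| tensrel_l k a a' b :
    tensrel (<< (k *: a + a', b) >> - (k *: << (a, b) >> + << (a', b) >>))
| tensrel_r k a b b' :
    tensrel (<< (a, k *: b + b') >> - (k *: << (a, b) >> + << (a, b') >>)).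

Definition tens : lmodType K := freequot tensrel.
Definition tpair (a : A) (b : B) : tens := fqgen tensrel (a, b).

Definition bilinear_fun (U : lmodType K) (phi : A -> B -> U) : Prop :=
  (forall b, linear (phi^~ b)) /\ (forall a, linear (phi a)).

Lemma tpair_bilinear : bilinear_fun tpair.
Proof.
split=> [b k a a'|a k b b']; rewrite /tpair /fqgen -linearP.
  by apply/fqpi_eq/relspan_rel/tensrel_l.
by apply/fqpi_eq/relspan_rel/tensrel_r.
Qed.

Lemma tpair_ind (P : tens -> Prop) :
  P 0 -> (forall k x y, P x -> P y -> P (k *: x + y)) ->
  (forall a b, P (tpair a b)) -> forall x, P x.
Proof. by move=> P0 Plin Pp; apply: fqgen_ind => // -[a b]; apply: Pp. Qed.

Section Lift.
Variables (U : lmodType K) (phi : A -> B -> U).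
Hypothesis phiB : bilinear_fun phi.

Let phi2 (x : A * B) := phi x.1 x.2.

Lemma tensrel_lift x : tensrel x -> fglift phi2 x = 0.
Proof.
case: phiB => lin1 lin2; case=> [k a a' b|k a b b'];
  rewrite addrC -scaleN1r !fglift_linear !liftU !scale1r /phi2 /=.
  by rewrite lin1 scaleN1r addNr.
by rewrite lin2 scaleN1r addNr.
Qed.

Definition blift : {linear tens -> U} :=
  HB.pack (@fqlift K (A * B)%type tensrel U phi2 : tens -> U)
    (GRing.isLinear.Build K tens U _ (@fqlift K (A * B)%type tensrel U phi2)
       (fqlift_linear tensrel_lift)).

Lemma bliftE a b : blift (tpair a b) = phi a b.
Proof. exact: (fqlift_gen tensrel_lift). Qed.
End Lift.

End Tensor.

(* A Z^n-grading V = (+)_a V^a, given by the projections gpr a of V onto V^a: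
   the axioms say that they are orthogonal idempotents and that each vector is a
   finite sum of its components; gprK makes all its other components vanish. *)
Record gradedSpace (K : fieldType) (n : nat) := GradedSpace {
  gsort :> lmodType K;
  gpr : 'rV[int]_n -> gsort -> gsort;
  gpr_linear : forall a, linear (gpr a);
  gprK : forall a b v, gpr a (gpr b v) = if a == b then gpr b v else 0;
  gpr_fin : forall v, exists s, uniq s /\ v = \sum_(a <- s) gpr a v }.

Arguments gpr {K n g}.

HB.instance Definition _ (K : fieldType) (n : nat) (V : gradedSpace K n) a :=
  GRing.isLinear.Build K V V _ (@gpr K n V a) (@gpr_linear K n V a).

Definition homog (K : fieldType) n (V : gradedSpace K n) (a : 'rV[int]_n) (v : V) : Prop :=
  gpr a v = v.

Definition has_weight (K : fieldType) n (V V' : gradedSpace K n) (c : 'rV[int]_n)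
    (f : V -> V') : Prop :=
  forall a v, homog a v -> homog (a + c) (f v).

Definition dotp n (a b : 'rV[int]_n) : int := \sum_i a 0 i * b 0 i.

(* e_1 needs n >= 1, whence the gradings by 'rV[int]_n.+1 below. *)
Definition e1 n : 'rV[int]_n.+1 := delta_mx 0 0.

Section Graded.
Variables (K : fieldType) (n : nat) (V : gradedSpace K n).
Local Notation G := 'rV[int]_n.

Definition gsupp (v : V) : seq G := projT1 (cid (gpr_fin v)).

Lemma gsupp_uniq v : uniq (gsupp v).
Proof. by rewrite /gsupp; case: cid => s [] /=. Qed.

Lemma gsuppE v : v = \sum_(a <- gsupp v) gpr a v.
Proof. by rewrite /gsupp; case: cid => s [] /=. Qed.

Lemma gpr_id a (v : V) : gpr a (gpr a v) = gpr a v.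
Proof. by rewrite gprK eqxx. Qed.

Lemma gpr_supp a (v : V) : a \notin gsupp v -> gpr a v = 0.
Proof.
move=> sa; rewrite [v]gsuppE linear_sum big_seq big1 // => b sb.
by rewrite /= gprK; case: eqP => // ab; rewrite ab sb in sa.
Qed.

Lemma big_gsupp (U : lmodType K) (F : G -> U) (v : V) (s : seq G) :
  (forall a, gpr a v = 0 -> F a = 0) -> uniq s -> {subset gsupp v <= s} ->
  \sum_(a <- gsupp v) F a = \sum_(a <- s) F a.
Proof.
move=> F0 us sub; rewrite [RHS](bigID (mem (gsupp v))) /= [X in _ + X]big1.
  rewrite addr0 -[RHS]big_filter; apply/perm_big/uniq_perm.
  - exact: gsupp_uniq.
  - exact: filter_uniq.
  by move=> a; rewrite mem_filter; case: (boolP (a \in gsupp v)) => //= /sub ->.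
by move=> a /gpr_supp/F0.
Qed.

Lemma gsupp_lin (U : lmodType K) (F : G -> V -> U) k (v w : V) :
  (forall a, linear (F a)) ->
  \sum_(a <- gsupp (k *: v + w)) F a (gpr a (k *: v + w)) =
  k *: \sum_(a <- gsupp v) F a (gpr a v) + \sum_(a <- gsupp w) F a (gpr a w).
Proof.
move=> linF; have F0 a : F a 0 = 0.
  by have := linF a (-1) 0 0; rewrite scaler0 addr0 scaleN1r addNr.
pose s := undup (gsupp (k *: v + w) ++ gsupp v ++ gsupp w).
have us : uniq s by exact: undup_uniq.
have sub (x : V) : x \in [:: k *: v + w; v; w] -> {subset gsupp x <= s}.
  by rewrite !inE => /or3P[]/eqP-> a ax; rewrite mem_undup !mem_cat ax ?orbT.
rewrite !(@big_gsupp _ _ _ s) //; try (by move=> a ->); try by apply: sub; rewrite !inE eqxx ?orbT.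
rewrite scaler_sumr -big_split /=; apply: eq_bigr => a _.
by rewrite gpr_linear linF.
Qed.

(* The linear map v |-> (-1)^<c, v> v. *)
Definition ksign (c : G) (v : V) : V :=
  \sum_(a <- gsupp v) ((-1) ^ dotp c a : K) *: gpr a v.

Lemma ksign_linear c : linear (ksign c).
Proof.
move=> k v w; rewrite /ksign.
apply: (@gsupp_lin V (fun a x => (-1) ^ dotp c a *: x)) => a k' x y.
by rewrite scalerDr !scalerA mulrC.
Qed.

HB.instance Definition _ c := GRing.isLinear.Build K V V _ (ksign c) (ksign_linear c).

Lemma big_homog (U : lmodType K) (F : G -> V -> U) a (v : V) :
  (forall b, F b 0 = 0) -> homog a v ->
  \sum_(b <- gsupp v) F b (gpr b v) = F a v.
Proof.
move=> F0 va; pose s := undup (a :: gsupp v).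
rewrite (@big_gsupp _ _ _ s) ?undup_uniq //; first last.
- by move=> b bv; rewrite mem_undup inE bv orbT.
- by move=> b ->.
rewrite (bigD1_seq a) ?undup_uniq //= ?mem_undup ?mem_head //.
rewrite [gpr a v]va big1 ?addr0 // => b ba.
by rewrite -va gprK (negPf ba).
Qed.

Lemma ksignE c a (v : V) : homog a v -> ksign c v = (-1) ^ dotp c a *: v.
Proof.
move=> va; rewrite /ksign (big_homog (F := fun b x => (-1) ^ dotp c b *: x) _ va) //.
by move=> b; rewrite scaler0.
Qed.

(* A word of homogeneous letters is a list of pairs (degree, letter); hsum phi w is the sum of phi over the
   homogeneous components of w. *)
Fixpoint hsum (U : lmodType K) (phi : seq (G * V) -> U) (w : seq V) : U :=
  if w is x :: w' then
    \sum_(a <- gsupp x) hsum (fun h => phi ((a, gpr a x) :: h)) w'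
  else phi [::].

Definition hmultilinear (U : lmodType K) (phi : seq (G * V) -> U) : Prop :=
  forall a k x y u v,
    phi (u ++ (a, k *: x + y) :: v) =
    k *: phi (u ++ (a, x) :: v) + phi (u ++ (a, y) :: v).

Definition hhomog (h : seq (G * V)) : Prop := forall x, x \in h -> homog x.1 x.2.

Definition hdeg (h : seq (G * V)) : G := \sum_(x <- h) x.1.

Lemma eq_hsum (U : lmodType K) (f g : seq (G * V) -> U) w :
  f =1 g -> hsum f w = hsum g w.
Proof.
elim: w f g => [|x w IHw] f g fg //=; apply: eq_bigr => a _.
by apply: IHw => h; apply: fg.
Qed.

Lemma hsum_lin (U : lmodType K) (f g : seq (G * V) -> U) k w :
  hsum (fun h => k *: f h + g h) w = k *: hsum f w + hsum g w.
Proof.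
elim: w f g => [|x w IHw] f g //=.
by rewrite scaler_sumr -big_split /=; apply: eq_bigr => a _; rewrite IHw.
Qed.

Lemma hsum_multilinear (U : lmodType K) (phi : seq (G * V) -> U) :
  hmultilinear phi -> multilinear (hsum phi).
Proof.
move=> phiM k x y u v; elim: u phi phiM => [|z u IHu] phi phiM /=.
  apply: (@gsupp_lin U (fun a x => hsum (fun h => phi ((a, x) :: h)) v)) => a k' x' y'.
  by rewrite -hsum_lin; apply: eq_hsum => h; apply: (phiM _ _ _ _ [::]).
rewrite scaler_sumr -big_split /=; apply: eq_bigr => a _.
by apply: IHu => b k' x' y' u' v'; apply: (phiM _ _ _ _ (_ :: _)).
Qed.

Lemma hmultilinear0 (U : lmodType K) (phi : seq (G * V) -> U) a u v :
  hmultilinear phi -> phi (u ++ (a, 0) :: v) = 0.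
Proof.
by move=> /(_ a (-1) 0 0 u v); rewrite scaler0 addr0 scaleN1r addNr.
Qed.

Lemma hsum_homog (U : lmodType K) (phi : seq (G * V) -> U) h :
  hmultilinear phi -> hhomog h -> hsum phi (map snd h) = phi h.
Proof.
elim: h phi => [|x h IHh] phi phiM hh //=.
have hhh : hhomog h by move=> y yh; apply: hh; rewrite inE yh orbT.
transitivity (\sum_(a <- gsupp x.2) phi ((a, gpr a x.2) :: h)).
  apply: eq_bigr => a _; apply: IHh => // b k' x' y' u' v'.
  exact: (phiM _ _ _ _ (_ :: _)).
rewrite (big_homog (F := fun a y => phi ((a, y) :: h)) (a := x.1)) -?surjective_pairing //.
  by move=> b; apply: (@hmultilinear0 U phi b [::]).
by apply: hh; rewrite mem_head.
Qed.

Lemma multilinear_sum (U : lmodType K) (phi : seq V -> U) (I : Type) (s : seq I) F u v :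
  multilinear phi ->
  phi (u ++ (\sum_(i <- s) F i) :: v) = \sum_(i <- s) phi (u ++ F i :: v).
Proof.
move=> phiM; elim: s => [|i s IHs].
  by rewrite !big_nil; have := phiM (-1) 0 0 u v; rewrite scaler0 addr0 scaleN1r addNr.
by rewrite !big_cons -IHs -[F i]scale1r phiM !scale1r.
Qed.

Lemma hsum_map (U : lmodType K) (phi : seq V -> U) w :
  multilinear phi -> hsum (fun h => phi (map snd h)) w = phi w.
Proof.
elim: w phi => [|x w IHw] phi phiM //=.
transitivity (\sum_(a <- gsupp x) phi (gpr a x :: w)).
  apply: eq_bigr => a _; apply: (IHw (fun v => phi (gpr a x :: v))) => k y z u v.
  exact: (phiM _ _ _ (_ :: _)).
by rewrite -(multilinear_sum _ (fun a => gpr a x) [::] w) // -gsuppE.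
Qed.

Lemma hsum_ind (U : lmodType K) (P : U -> Prop) (phi : seq (G * V) -> U) w :
  P 0 -> (forall x y, P x -> P y -> P (x + y)) ->
  (forall h, hhomog h -> P (phi h)) -> P (hsum phi w).
Proof.
move=> P0 PD; elim: w phi => [|x w IHw] phi Pphi /=; first exact: Pphi.
apply: big_ind => // a _; apply: IHw => h hh; apply: Pphi => y.
by rewrite inE => /predU1P[->|/hh//]; rewrite /homog /= gpr_id.
Qed.

Lemma hword_ind (P : tmod V -> Prop) :
  P 0 -> (forall k x y, P x -> P y -> P (k *: x + y)) ->
  (forall h, hhomog h -> P (word (map snd h))) -> forall x, P x.
Proof.
move=> P0 Plin Ph; apply: word_ind => // w.
rewrite -(hsum_map _ (@word_multilinear K V)); apply: hsum_ind => // x y Px Py.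
by rewrite -[x]scale1r; apply: Plin.
Qed.

Definition hcomp (a : G) (h : seq (G * V)) : tmod V :=
  if hdeg h == a then word (map snd h) else 0.

Lemma hcomp_multilinear a : hmultilinear (hcomp a).
Proof.
move=> b k x y u v; rewrite /hcomp /hdeg !big_cat !big_cons /=.
case: ifP => _; last by rewrite scaler0 addr0.
by rewrite !map_cat /= word_multilinear.
Qed.

Lemma hcomp_nil a : hsum (hcomp a) [::] = 0.
Proof. by rewrite /= /hcomp /= word_nil if_same. Qed.

(* The component of total degree a. *)
Definition tgpr (a : G) : tmod V -> tmod V :=
  tlift (hcomp_nil a) (hsum_multilinear (hcomp_multilinear a)).

Lemma tgprE a h : hhomog h ->
  tgpr a (word (map snd h)) = if hdeg h == a then word (map snd h) else 0.
Proof.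
move=> hh; rewrite /tgpr tliftE hsum_homog //; exact: hcomp_multilinear.
Qed.

Lemma tgpr_linear a : linear (tgpr a).
Proof. exact: linearP. Qed.

HB.instance Definition _ a :=
  GRing.isLinear.Build K (tmod V) (tmod V) _ (tgpr a) (tgpr_linear a).

Lemma tgprK a b x : tgpr a (tgpr b x) = if a == b then tgpr b x else 0.
Proof.
elim/hword_ind: x => [|k x y IHx IHy|h hh].
- by rewrite !linear0 if_same.
- rewrite tgpr_linear tgpr_linear IHx IHy; case: ifP => _ //.
  by rewrite scaler0 addr0.
rewrite !tgprE //; case: (eqVneq (hdeg h) b) => [<-|_]; last by rewrite linear0 if_same.
by rewrite tgprE // eq_sym.
Qed.

Lemma tgpr_fin x : exists s, uniq s /\ x = \sum_(a <- s) tgpr a x.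
Proof.
suff [s sx] : exists s : seq G, forall t, uniq t -> {subset s <= t} ->
    x = \sum_(a <- t) tgpr a x.
  exists (undup s); split; first exact: undup_uniq.
  by apply: sx => [|a]; rewrite ?undup_uniq ?mem_undup.
elim/hword_ind: x => [|k x y [sx IHx] [sy IHy]|h hh].
- by exists [::] => t _ _; rewrite big1 // => a _; rewrite linear0.
- exists (sx ++ sy) => t ut st.
  have -> : \sum_(a <- t) tgpr a (k *: x + y) =
            k *: \sum_(a <- t) tgpr a x + \sum_(a <- t) tgpr a y.
    by rewrite scaler_sumr -big_split; apply: eq_bigr => a _; rewrite tgpr_linear.
  rewrite -IHx -?IHy // => a as_; apply: st; rewrite mem_cat as_ ?orbT //.
exists [:: hdeg h] => t ut st.
rewrite (bigD1_seq (hdeg h)) ?st ?mem_head //= tgprE // eqxx big1 ?addr0 // => a.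
by rewrite tgprE // eq_sym => /negPf ->.
Qed.

(* T(V), graded by total degree. *)
Definition tcoalg : gradedSpace K n :=
  @GradedSpace K n (tmod V) tgpr tgpr_linear tgprK tgpr_fin.

Local Notation h0 := ((0, 0) : G * V).

(* For h = ((a_1, w_1), ..., (a_p, w_p)) with w_i of degree a_i, m = p - 1 and
   positions numbered from 0, hsub h I is W_I, and (-1)^(koszul h I) is the
   Koszul sign of the pair (I, J), J being the complement of I in the first
   m positions. *)
Definition hsub (m : nat) (h : seq (G * V)) (I : {set 'I_m}) : seq V :=
  [seq (nth h0 h i).2 | i : 'I_m <- enum I].

Definition koszul (m : nat) (h : seq (G * V)) (I : {set 'I_m}) : int :=
  \sum_(i in I) \sum_(j in ~: I | (j < i)%N)
     dotp (nth h0 h i).1 (nth h0 h j).1.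

Definition hcop_ (m : nat) (h : seq (G * V)) : tens tcoalg tcoalg :=
  \sum_(I : {set 'I_m} | I != set0)
     (-1) ^ koszul h I *:
       tpair (word (hsub h I) : tcoalg)
             (word (rcons (hsub h (~: I)) (last h0 h).2) : tcoalg).

Definition hcop (h : seq (G * V)) : tens tcoalg tcoalg := hcop_ (size h).-1 h.

Lemma hcop_nil : hsum hcop [::] = 0.
Proof.
rewrite /= /hcop /hcop_ big_pred0 // => I; apply/negbTE/negPn/eqP/setP => -[] //.
Qed.

Lemma hsub_pos a u v (s : seq nat) : uniq s ->
  let f x := [seq (nth h0 (u ++ (a, x) :: v) i).2 | i <- s] in
  if size u \in s then exists p q, forall x : V, f x = p ++ x :: q
  else exists p : seq V, forall x : V, f x = p.
Proof.
move=> us f; have nE x y i : i != size u ->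
    nth h0 (u ++ (a, x) :: v) i = nth h0 (u ++ (a, y) :: v) i.
  move=> iu; rewrite !nth_cat; case: ltnP => // ui.
  by rewrite -[(i - _)%N]prednK // subn_gt0 ltn_neqAle eq_sym iu.
have cst (t : seq nat) x y : size u \notin t ->
    [seq (nth h0 (u ++ (a, x) :: v) i).2 | i <- t] =
    [seq (nth h0 (u ++ (a, y) :: v) i).2 | i <- t].
  move=> ut; apply/eq_in_map => i it; rewrite (nE x y) //.
  by apply: contraNneq ut => <-.
case: ifPn => [us1|us1]; last by exists (f 0) => x; apply: cst.
case/splitPr: us1 us @f => s1 s2; rewrite cat_uniq /= negb_or.
case/and3P => _ /andP[n1 _] /andP[n2 _].
exists [seq (nth h0 (u ++ (a, 0) :: v) i).2 | i <- s1].
exists [seq (nth h0 (u ++ (a, 0) :: v) i).2 | i <- s2] => x.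
by rewrite map_cat /= nth_cat ltnn subnn /= (cst s1 x 0) // (cst s2 x 0).
Qed.

Lemma hcop_multilinear : hmultilinear hcop.
Proof.
move=> a k x y u v; rewrite /hcop !size_cat /= !addnS /=.
set m := (size u + size v)%N; rewrite /hcop_ scaler_sumr -big_split /=.
apply: eq_bigr => I _.
have kE (z z' : V) : koszul (u ++ (a, z) :: v) I = koszul (u ++ (a, z') :: v) I.
  have dE i : (nth h0 (u ++ (a, z) :: v) i).1 = (nth h0 (u ++ (a, z') :: v) i).1.
    by rewrite !nth_cat; case: ltnP => // _; case: (i - _)%N.
  by apply: eq_bigr => i _; apply: eq_bigr => j _; rewrite !dE.
rewrite (kE (k *: x + y) 0) (kE x 0) (kE y 0) scalerA mulrC -scalerA -scalerDr.
congr (_ *: _); pose s1 := [seq val i | i <- enum I].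
pose s2 := rcons [seq val i | i <- enum (~: I)] m.
have e1 z : hsub (u ++ (a, z) :: v) I =
    [seq (nth h0 (u ++ (a, z) :: v) i).2 | i <- s1] by rewrite -map_comp.
have e2 z : rcons (hsub (u ++ (a, z) :: v) (~: I)) (last h0 (u ++ (a, z) :: v)).2 =
    [seq (nth h0 (u ++ (a, z) :: v) i).2 | i <- s2].
  by rewrite map_rcons -map_comp -nth_last size_cat /= addnS.
have us1 : uniq s1 by rewrite map_inj_uniq ?enum_uniq //; apply: val_inj.
have us2 : uniq s2.
  rewrite rcons_uniq map_inj_uniq ?enum_uniq ?andbT //; last exact: val_inj.
  by apply/mapP => -[i _ /= mi]; have := ltn_ord i; rewrite -mi ltnn.
have part : (size u \in s2) = (size u \notin s1).
  rewrite mem_rcons inE; have [um|um] := eqVneq (size u) m.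
    apply/esym/mapP => -[i _ /= mi]; have := ltn_ord i; rewrite -mi um ltnn //.
  have ltum : (size u < m)%N by rewrite ltn_neqAle um leq_addr.
  have -> : size u = val (Ordinal ltum) by [].
  by rewrite !(mem_map val_inj) !mem_enum in_setC.
have := hsub_pos a u v us1; have := hsub_pos a u v us2; rewrite part.
case: (boolP (size u \in s1)) => _ /= => [[q qE] [p1 [p2 pE]]|[p1 [p2 pE]] [q qE]].
  by rewrite !e1 !e2 !pE !qE word_multilinear (tpair_bilinear _ _).1.
by rewrite !e1 !e2 !pE !qE word_multilinear (tpair_bilinear _ _).2.
Qed.

Definition coproduct : {linear tcoalg -> tens tcoalg tcoalg} :=
  tlift hcop_nil (hsum_multilinear hcop_multilinear).

Lemma coproductE h : hhomog h -> coproduct (word (map snd h)) = hcop h.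
Proof. by move=> hh; rewrite tliftE hsum_homog //; apply: hcop_multilinear. Qed.

End Graded.

Section TensorMaps.
Variables (K : fieldType) (n : nat) (A : gradedSpace K n) (B A' B' : lmodType K).
Variables (c : 'rV[int]_n) (f : {linear A -> A'}) (g : {linear B -> B'}).

Lemma tensmap_bilinear :
  bilinear_fun (fun (x : A) (y : B) => tpair (f (ksign c x)) (g y)).
Proof.
split=> [b k x y|a k x y] /=; rewrite !linearP.
  by rewrite (tpair_bilinear _ _).1.
by rewrite (tpair_bilinear _ _).2.
Qed.

(* f (x) g with the Koszul sign, where c is the weight of g. *)
Definition tensmap : {linear tens A B -> tens A' B'} := blift tensmap_bilinear.

Lemma tensmapE a x y : homog a x ->
  tensmap (tpair x y) = ((-1) ^ dotp c a : K) *: tpair (f x) (g y).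
Proof.
move=> xa; rewrite bliftE (ksignE _ xa) linearZ /=.
set k := _ ^ _; have t0 : tpair (0 : A') (g y) = 0.
  have := (tpair_bilinear A' B').1 (g y) (-1) 0 0.
  by rewrite scaler0 addr0 scaleN1r addNr.
by have := (tpair_bilinear A' B').1 (g y) k (f x) 0; rewrite addr0 t0 addr0.
Qed.

End TensorMaps.

Section Coalgebra.
Variables (K : fieldType) (n : nat).

Definition coderivation (W : gradedSpace K n) (c : 'rV[int]_n)
    (Q : {linear tcoalg W -> tcoalg W}) : Prop :=
  has_weight c Q /\
  forall x, coproduct W (Q x) =
    tensmap 0 Q idfun (coproduct W x) + tensmap c idfun Q (coproduct W x).

Definition codifferential (W : gradedSpace K n) (c : 'rV[int]_n)
    (Q : {linear tcoalg W -> tcoalg W}) : Prop :=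
  coderivation c Q /\ forall x, Q (Q x) = 0.

Definition cohomomorphism (W W' : gradedSpace K n)
    (F : {linear tcoalg W -> tcoalg W'}) : Prop :=
  has_weight 0 F /\
  forall x, coproduct W' (F x) = tensmap 0 F F (coproduct W x).

(* F_p(w_1 (x) ... (x) w_p), for all p at once. *)
Definition corestriction (W W' : gradedSpace K n)
    (F : {linear tcoalg W -> tcoalg W'}) (w : seq W) : W' :=
  tproj W' (F (word w)).

End Coalgebra.

Section DirectSum.
Variables (K : fieldType) (n : nat) (V V' : gradedSpace K n).
Local Notation VV := (V * V')%type.

Definition dsum_pr (a : 'rV[int]_n) (x : VV) : VV := (gpr a x.1, gpr a x.2).

Lemma dsum_pr_linear a : linear (dsum_pr a).
Proof. by move=> k x y; rewrite /dsum_pr /= !gpr_linear. Qed.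

Lemma dsum_prK a b x : dsum_pr a (dsum_pr b x) = if a == b then dsum_pr b x else 0.
Proof. by rewrite /dsum_pr /= !gprK; case: ifP. Qed.

Lemma dsum_pr_fin x : exists s, uniq s /\ x = \sum_(a <- s) dsum_pr a x.
Proof.
exists (undup (gsupp x.1 ++ gsupp x.2)); split; first exact: undup_uniq.
have fE (s : seq 'rV[int]_n) : \sum_(a <- s) dsum_pr a x =
    (\sum_(a <- s) gpr a x.1, \sum_(a <- s) gpr a x.2).
  by elim: s => [|a s IHs]; rewrite ?big_nil // !big_cons IHs.
rewrite fE -(big_gsupp (F := fun a => gpr a x.1) (v := x.1)) ?undup_uniq //; last first.
  by move=> a ax; rewrite mem_undup mem_cat ax.
rewrite -(big_gsupp (F := fun a => gpr a x.2) (v := x.2)) ?undup_uniq //; last first.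
  by move=> a ax; rewrite mem_undup mem_cat ax orbT.
by rewrite -!gsuppE -surjective_pairing.
Qed.

Definition dsum : gradedSpace K n :=
  @GradedSpace K n VV dsum_pr dsum_pr_linear dsum_prK dsum_pr_fin.

End DirectSum.

Section Desuspension.
Variables (K : fieldType) (n : nat) (V : gradedSpace K n.+1).

Definition desusp_pr (a : 'rV[int]_n.+1) : V -> V := gpr (a + e1 n).

Lemma desusp_pr_linear a : linear (desusp_pr a).
Proof. exact: gpr_linear. Qed.

Lemma desusp_prK a b v :
  desusp_pr a (desusp_pr b v) = if a == b then desusp_pr b v else 0.
Proof. by rewrite /desusp_pr gprK (inj_eq (addIr _)). Qed.

Lemma desusp_pr_fin v : exists s, uniq s /\ v = \sum_(a <- s) desusp_pr a v.
Proof.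
exists [seq a - e1 n | a <- gsupp v]; split.
  by rewrite map_inj_uniq ?gsupp_uniq //; apply: addIr.
rewrite big_map {1}[v]gsuppE; apply: eq_bigr => a _.
by rewrite /desusp_pr subrK.
Qed.

(* The same vector space, with (desusp V)^a = V^(a + e1). *)
Definition desusp : gradedSpace K n.+1 :=
  @GradedSpace K n.+1 V desusp_pr desusp_pr_linear desusp_prK desusp_pr_fin.

Definition down (v : V) : desusp := v.
Definition up (v : desusp) : V := v.

(* The letters of (down (x) ... (x) down)(v_1, ..., v_p). Moving the last p - 1
   factors, of total weight - (p - 1) e1, past v_1 gives the sign on v_1. *)
Fixpoint downs (s : seq V) : seq desusp :=
  if s is v :: s' then down (ksign (- e1 n *+ size s') v) :: downs s' else [::].

End Desuspension.

Section Lod.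
Variables (K : fieldType) (n : nat).
Implicit Types V : gradedSpace K n.+1.

Record lodInf V := LodInf {
  lodQ :> {linear tcoalg (desusp V) -> tcoalg (desusp V)};
  lodQP : codifferential (e1 n) lodQ }.

Record lodMorphism V V' (Q : lodInf V) (Q' : lodInf V') := LodMorphism {
  lodF :> {linear tcoalg (desusp V) -> tcoalg (desusp V')};
  lodF_cohom : cohomomorphism lodF;
  lodF_comm : forall x, Q' (lodF x) = lodF (Q x) }.

(* pi_p(v_1, ..., v_p), p >= 1, as a function of the list of arguments. *)
Definition lod_pi V (Q : lodInf V) (v : seq V) : V :=
  up (corestriction Q (downs v)).

(* f_p(v_1, ..., v_p), p >= 1. *)
Definition lod_f V V' (Q : lodInf V) (Q' : lodInf V') (F : lodMorphism Q Q')
    (v : seq V) : V' :=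
  up (corestriction F (downs v)).

Definition lod_iso V V' (Q : lodInf V) (Q' : lodInf V') (F : lodMorphism Q Q') : Prop :=
  bijective (fun v : V => lod_f F [:: v]).

Definition lod_isomorphic V V' (Q : lodInf V) (Q' : lodInf V') : Prop :=
  exists F : lodMorphism Q Q', lod_iso F.

Definition minimal V (Q : lodInf V) : Prop := forall v, lod_pi Q [:: v] = 0.

(* The second condition is ker pi_1 = im pi_1, im pi_1 <= ker pi_1 being automatic. *)
Definition contractible V (Q : lodInf V) : Prop :=
  (forall v : seq V, (1 < size v)%N -> lod_pi Q v = 0) /\
  (forall v, lod_pi Q [:: v] = 0 -> exists u, v = lod_pi Q [:: u]).

(* D is the Lod_oo structure on V (+) V' represented by pi (+) pi'; structure
   maps determine a coderivation, so D is unique. *)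
Definition is_direct_sum V V' (Q : lodInf V) (Q' : lodInf V')
    (D : lodInf (dsum V V')) : Prop :=
  forall v : seq (dsum V V'),
    lod_pi D v = (lod_pi Q [seq x.1 | x <- v], lod_pi Q' [seq x.2 | x <- v]).

End Lod.

(* Main.v *)
Require Import Defs.
From HB Require Import structures.
From mathcomp Require Import all_boot all_order all_algebra.
From mathcomp Require Import boolp zify.
From mathcomp Require classical_sets.

Set Implicit Arguments.
Unset Strict Implicit.
Unset Printing Implicit Defensive.

Import GRing.Theory.
Local Open Scope ring_scope.

(** Write W for the desuspension of V, t for the projection of T(W) onto its
    letters, and d for the restriction t Q of Q to the letters.

    On W, an arbitrary generalized inverse of d can be corrected into a map s
    of opposite weight with d s d = d, s d s = s, s s = 0 ([homotopy]). Then
    p = d s + s d is an idempotent that commutes with d; its image is acyclic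
    and 1 - p has its image in ker d. So the linear part splits; the two
    summands become C and M, and two changes of coordinates spread the
    splitting to all of Q.

    The first one uses that a morphism to a contractible algebra is only a
    chain map to its letters. The map d s t + s t Q is a chain map from T(W)
    to the image of p, because Q Q = 0 and d d = 0, and on letters it is p.
    The cohomomorphism G with corestriction t - p t + (d s t + s t Q) is the
    identity on letters, hence invertible, and after transport along it
    p t Q = d p t ([straightened]). In particular the words in the image of
    1 - p now span a subcomplex T(M).

    The second one needs a retraction of T(W) onto T(M). Let S be the
    coderivation that extends s. The anticommutator L = Q S + S Q is a
    coderivation of weight 0 that commutes with Q, vanishes on T(M), and up to
    shorter words multiplies a word by its number of letters in the image of p.
    In characteristic 0 the kernel of L is therefore T(M), and T(W) is the
    direct sum of T(M) and the image of L. The projection P onto T(M) along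
    the image of L commutes with Q because L does, and it is a cohomomorphism
    because L is a coderivation ([splitting_projector]). The pair consisting of
    P and p t is then an isomorphism onto the direct sum
    ([splitting_isomorphism]).

    All of this rests on cohomomorphisms and coderivations being determined by
    their corestrictions, and existing for every corestriction that is needed.
    Both follow from two properties of the coproduct D and of its
    symmetrization D' = D + (signed flip) D. A word is recovered from D by
    cutting off its last letter, x = t x + cat (1 (x) t) D x ([reconstruct]),
    which turns the defining equations into recursions on the length; and the
    co-Zinbiel identity (1 (x) D) D = (D' (x) 1) D ([coZinbiel]) makes the
    solutions of these recursions compatible with D. *)

(** * Koszul signs and tensor products of linear maps *)

(** The maps given by universal properties are locked, so that simplification
    does not open them; distinct indices keep conversion from comparing the
    bodies of two different ones. *)
Fact lock_key (i : nat) : unit. Proof. exact: tt. Qed.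

Section Signs.
Variables (K : fieldType) (n : nat).
Implicit Types a b c : 'rV[int]_n.

Lemma dotpC a b : dotp a b = dotp b a.
Proof. by apply: eq_bigr => i _; rewrite mulrC. Qed.
Lemma dotpDr a b c : dotp a (b + c) = dotp a b + dotp a c.
Proof. by rewrite -big_split; apply: eq_bigr => i _; rewrite mxE mulrDr. Qed.
Lemma dotpDl a b c : dotp (a + b) c = dotp a c + dotp b c.
Proof. by rewrite dotpC dotpDr !(dotpC c). Qed.
Lemma dotp0 a : dotp a 0 = 0.
Proof. by apply: big1 => i _; rewrite mxE mulr0. Qed.
Lemma dot0p a : dotp 0 a = 0.
Proof. by rewrite dotpC dotp0. Qed.
Lemma dotpNr a b : dotp a (- b) = - dotp a b.
Proof. by apply/eqP; rewrite -addr_eq0 -dotpDr addNr dotp0. Qed.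
Lemma dotpNl a b : dotp (- a) b = - dotp a b.
Proof. by rewrite dotpC dotpNr dotpC. Qed.
Lemma dotp_suml (I : Type) (r : seq I) (P : pred I) (F : I -> 'rV[int]_n) b :
  dotp (\sum_(i <- r | P i) F i) b = \sum_(i <- r | P i) dotp (F i) b.
Proof.
by rewrite (big_morph (fun a => dotp a b) (fun x y => dotpDl x y b) (dot0p b)).
Qed.

Definition ksgn (z : int) : K := (-1) ^ z.

Lemma ksgnD x y : ksgn (x + y) = ksgn x * ksgn y.
Proof. by rewrite /ksgn expfzDr // oppr_eq0 oner_eq0. Qed.
Lemma ksgnM x : ksgn x * ksgn x = 1.
Proof. by rewrite /ksgn; case: x => m; rewrite /exprz ?invr_sign -expr2 sqrr_sign. Qed.
Lemma ksgnN x : ksgn (- x) = ksgn x.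
Proof. by rewrite -[LHS]mulr1 -(ksgnM x) mulrA -ksgnD addNr mul1r. Qed.

End Signs.

Section TensorMap.
Variable K : fieldType.

Lemma lin0 (U U' : lmodType K) (f : U -> U') : linear f -> f 0 = 0.
Proof. by move=> /(_ (-1) 0 0); rewrite scaler0 addr0 scaleN1r addNr. Qed.

Lemma linZ (U U' : lmodType K) (f : U -> U') : linear f ->
  forall k x, f (k *: x) = k *: f x.
Proof. by move=> fl k x; rewrite -[k *: x]addr0 fl (lin0 fl) addr0. Qed.

Section Pair.
Variables A B : lmodType K.

Lemma tpair0l (b : B) : tpair (0 : A) b = 0.
Proof. exact: (lin0 ((tpair_bilinear A B).1 b)). Qed.
Lemma tpair0r (a : A) : tpair a (0 : B) = 0.
Proof. exact: (lin0 ((tpair_bilinear A B).2 a)). Qed.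
Lemma tpairZl k (a : A) (b : B) : tpair (k *: a) b = k *: tpair a b.
Proof. exact: (linZ ((tpair_bilinear A B).1 b)). Qed.
Lemma tpairZr k (a : A) (b : B) : tpair a (k *: b) = k *: tpair a b.
Proof. exact: (linZ ((tpair_bilinear A B).2 a)). Qed.
Lemma tpairDl (a a' : A) (b : B) : tpair (a + a') b = tpair a b + tpair a' b.
Proof. by have := (tpair_bilinear A B).1 b 1 a a'; rewrite !scale1r. Qed.
Lemma tpairDr (a : A) (b b' : B) : tpair a (b + b') = tpair a b + tpair a b'.
Proof. by have := (tpair_bilinear A B).2 a 1 b b'; rewrite !scale1r. Qed.

Lemma tpairBl (a a' : A) (b : B) : tpair (a - a') b = tpair a b - tpair a' b.
Proof. by rewrite -!scaleN1r tpairDl tpairZl. Qed.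
Lemma tpairBr (a : A) (b b' : B) : tpair a (b - b') = tpair a b - tpair a b'.
Proof. by rewrite -!scaleN1r tpairDr tpairZr. Qed.

Lemma tens_ext (U : lmodType K) (f g : {linear tens A B -> U}) :
  (forall a b, f (tpair a b) = g (tpair a b)) -> f =1 g.
Proof.
move=> fg; elim/tpair_ind => [|k x y IHx IHy|a b]; rewrite ?linear0 //.
by rewrite !linearP IHx IHy.
Qed.
End Pair.

Section Map.
Variables (A B A' B' : lmodType K) (f : {linear A -> A'}) (g : {linear B -> B'}).
Lemma tmap_bilinear : bilinear_fun (fun (x : A) (y : B) => tpair (f x) (g y)).
Proof.
by split=> [b k x y|a k x y] /=; rewrite linearP ?tpairDl ?tpairDr ?tpairZl ?tpairZr.
Qed.
(** The tensor product without Koszul sign. The sign of a map of weight c is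
    carried by the operator [ksign c] composed with its left neighbour, which
    makes all identities between tensor products of maps equations between
    composites. *)
Definition tmap : {linear tens A B -> tens A' B'} :=
  locked_with (lock_key 1) (blift tmap_bilinear).
Lemma tmapE a b : tmap (tpair a b) = tpair (f a) (g b).
Proof. by rewrite /tmap unlock bliftE. Qed.
End Map.

Lemma eq_tmap (A B A' B' : lmodType K) (f f' : {linear A -> A'}) (g g' : {linear B -> B'}) :
  f =1 f' -> g =1 g' -> tmap f g =1 tmap f' g'.
Proof. by move=> ff gg; apply: tens_ext => a b; rewrite !tmapE ff gg. Qed.

Lemma tmap_comp (A B A' B' A'' B'' : lmodType K)
    (f : {linear A -> A'}) (g : {linear B -> B'})
    (f' : {linear A' -> A''}) (g' : {linear B' -> B''}) x :
  tmap f' g' (tmap f g x) = tmap (f' \o f) (g' \o g) x.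
Proof.
by move: x; apply: (@tens_ext _ _ _ (tmap f' g' \o tmap f g)) => a b /=; rewrite !tmapE.
Qed.

Lemma tmap_id (A B : lmodType K) (x : tens A B) : tmap idfun idfun x = x.
Proof. by move: x; apply: (@tens_ext _ _ _ _ idfun) => a b; rewrite tmapE. Qed.

Lemma tmapDr (A B A' B' : lmodType K) (f : {linear A -> A'}) (g g' : {linear B -> B'}) x :
  tmap f (g \+ g') x = tmap f g x + tmap f g' x.
Proof.
move: x; apply: (@tens_ext _ _ _ _ (tmap f g \+ tmap f g')) => a b /=.
by rewrite !tmapE /= tpairDr.
Qed.

Lemma tmap0l (A B A' B' : lmodType K) (f : {linear A -> A'}) (g : {linear B -> B'}) x :
  f =1 \0 -> tmap f g x = 0.
Proof.
move=> f0; move: x; apply: (@tens_ext _ _ _ _ \0) => a b /=.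
by rewrite tmapE f0 /= tpair0l.
Qed.

Lemma tmap0r (A B A' B' : lmodType K) (f : {linear A -> A'}) (g : {linear B -> B'}) x :
  g =1 \0 -> tmap f g x = 0.
Proof.
move=> g0; move: x; apply: (@tens_ext _ _ _ _ \0) => a b /=.
by rewrite tmapE g0 /= tpair0r.
Qed.

Section Assoc.
Variables A B C : lmodType K.

Lemma assoc1_bilinear (c : C) :
  bilinear_fun (fun (a : A) (b : B) => tpair a (tpair b c)).
Proof.
by split=> [b k x y|a k x y] /=; rewrite ?tpairDl ?tpairDr ?tpairZl ?tpairZr.
Qed.

Definition assoc1 (c : C) : {linear tens A B -> tens A (tens B C)} :=
  locked_with (lock_key 2) (blift (assoc1_bilinear c)).

Lemma assoc1E c a b : assoc1 c (tpair a b) = tpair a (tpair b c).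
Proof. by rewrite /assoc1 unlock bliftE. Qed.

Lemma assoc_bilinear :
  bilinear_fun (fun (z : tens A B) (c : C) => assoc1 c z).
Proof.
split=> [c k x y|z k c c'] /=; first by rewrite linearP.
elim/tpair_ind: z => [|m x y IHx IHy|a b].
- by rewrite !linear0 ?scaler0 addr0.
- rewrite !linearP IHx IHy !scalerDr !scalerA mulrC -!addrA; congr (_ + _).
  by rewrite addrCA.
by rewrite !assoc1E !tpairDr !tpairZr.
Qed.

Definition assoc : {linear tens (tens A B) C -> tens A (tens B C)} :=
  locked_with (lock_key 3) (blift assoc_bilinear).

Lemma assocE a b c : assoc (tpair (tpair a b) c) = tpair a (tpair b c).
Proof. by rewrite /assoc unlock bliftE assoc1E. Qed.

Lemma unassoc1_bilinear (a : A) :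
  bilinear_fun (fun (b : B) (c : C) => tpair (tpair a b) c).
Proof.
by split=> [b k x y|b k x y] /=; rewrite ?tpairDr ?tpairDl ?tpairZr ?tpairZl ?tpairDl ?tpairZl.
Qed.

Definition unassoc1 (a : A) : {linear tens B C -> tens (tens A B) C} :=
  locked_with (lock_key 4) (blift (unassoc1_bilinear a)).

Lemma unassoc1E a b c : unassoc1 a (tpair b c) = tpair (tpair a b) c.
Proof. by rewrite /unassoc1 unlock bliftE. Qed.

Lemma unassoc_bilinear :
  bilinear_fun (fun (a : A) (z : tens B C) => unassoc1 a z).
Proof.
split=> [z k a a'|a k x y] /=; last by rewrite linearP.
elim/tpair_ind: z => [|m x y IHx IHy|b c].
- by rewrite !linear0 ?scaler0 addr0.
- rewrite !linearP IHx IHy !scalerDr !scalerA mulrC -!addrA; congr (_ + _).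
  by rewrite addrCA.
by rewrite !unassoc1E !tpairDl !tpairZl.
Qed.

Definition unassoc : {linear tens A (tens B C) -> tens (tens A B) C} :=
  locked_with (lock_key 5) (blift unassoc_bilinear).

Lemma unassocE a b c : unassoc (tpair a (tpair b c)) = tpair (tpair a b) c.
Proof. by rewrite /unassoc unlock bliftE unassoc1E. Qed.

Lemma tens3_ext (U : lmodType K) (f g : {linear tens A (tens B C) -> U}) :
  (forall a b c, f (tpair a (tpair b c)) = g (tpair a (tpair b c))) -> f =1 g.
Proof.
move=> fg; apply: tens_ext => a z; elim/tpair_ind: z => [|k x y IHx IHy|b c //].
  by rewrite tpair0r !linear0.
by rewrite tpairDr tpairZr !linearP IHx IHy.
Qed.

Lemma unassocK : cancel assoc unassoc.
Proof.
apply: (@tens_ext _ _ _ (unassoc \o assoc) idfun) => z c /=.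
elim/tpair_ind: z => [|k x y IHx IHy|a b]; first by rewrite tpair0l !linear0.
  by rewrite tpairDl tpairZl !linearP IHx IHy.
by rewrite assocE unassocE.
Qed.

End Assoc.
Arguments assoc {A B C}.
Arguments unassoc {A B C}.

Lemma tens3l_ext (A B C U : lmodType K) (f g : {linear tens (tens A B) C -> U}) :
  (forall a b c, f (tpair (tpair a b) c) = g (tpair (tpair a b) c)) -> f =1 g.
Proof.
move=> fg; apply: tens_ext => z c; elim/tpair_ind: z => [|k x y IHx IHy|a b //].
  by rewrite tpair0l !linear0.
by rewrite tpairDl tpairZl !linearP IHx IHy.
Qed.

Lemma assoc_tmap (A B C A' B' C' : lmodType K) (f : {linear A -> A'})
    (g : {linear B -> B'}) (h : {linear C -> C'}) x :
  assoc (tmap (tmap f g) h x) = tmap f (tmap g h) (assoc x).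
Proof.
move: x; apply: (@tens3l_ext _ _ _ _ (assoc \o tmap (tmap f g) h)
  (tmap f (tmap g h) \o assoc)) => a b c /=.
by rewrite !(tmapE, assocE).
Qed.

End TensorMap.
Arguments assoc {K A B C}.
Arguments unassoc {K A B C}.

(** * Words, length filtration, signed flip and coproduct *)

Section TensorCoalgebra.
Variables (K : fieldType) (n : nat) (W : gradedSpace K n).
Local Notation T := (tcoalg W).
Local Notation G := 'rV[int]_n.
Implicit Types (a b : W) (w u v : seq W) (x y : T) (h : seq (G * W)).

Lemma inc_linear : linear (fun a : W => word [:: a] : T).
Proof. by move=> k a b; apply: (word_multilinear k a b [::] [::]). Qed.

Definition inc0 : {linear W -> T} :=
  HB.pack (fun a : W => word [:: a] : T) (GRing.isLinear.Build K W T _ _ inc_linear).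
Definition inc : {linear W -> T} := locked_with (lock_key 6) inc0.

Lemma incE a : inc a = word [:: a].
Proof. by rewrite /inc unlock. Qed.

Definition proj : {linear T -> W} := locked_with (lock_key 7) (tproj W : {linear tmod W -> W}).

Lemma projE w : proj (word w) = letter w.
Proof. by rewrite /proj unlock tliftE. Qed.

Lemma proj_inc a : proj (inc a) = a.
Proof. by rewrite incE projE. Qed.

(** The empty word is zero in T(W), so appending a letter must send it to zero
    and not to that letter. *)
Definition rappf a w : T := if w is [::] then 0 else word (rcons w a).

Lemma rappf_multilinear a : multilinear (rappf a).
Proof.
move=> k x y u v; have e z : rappf a (u ++ z :: v) = word (u ++ z :: rcons v a) :> T.
  by rewrite -rcons_cons -rcons_cat; case: u.
by rewrite !e word_multilinear.
Qed.

Definition rapp a : {linear T -> T} := locked_with (lock_key 8)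
  (tlift (erefl (rappf a [::])) (rappf_multilinear a) : {linear tmod W -> T}).

Lemma rappE0 a w : rapp a (word w) = rappf a w.
Proof. by rewrite /rapp unlock tliftE. Qed.

Lemma rappE a b w : rapp a (word (b :: w)) = word (rcons (b :: w) a).
Proof. exact: rappE0. Qed.

Lemma rapp_word a w : w != [::] -> rapp a (word w) = word (rcons w a).
Proof. by case: w => // b w _; rewrite rappE. Qed.

Lemma rapp_linear y : linear (fun a => rapp a y).
Proof.
move=> k a b; elim/word_ind: y => [|l x y IHx IHy|w].
- by rewrite !linear0 addr0.
- rewrite !linearP IHx IHy !scalerDr !scalerA mulrC -!addrA; congr (_ + _).
  by rewrite addrCA.
rewrite !rappE0; case: w => [|x w] /=; first by rewrite scaler0 addr0.
rewrite -!rcons_cons -!cats1; exact: (word_multilinear k a b (x :: w) [::]).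
Qed.

Lemma cat_bilinear : bilinear_fun (fun x a => rapp a x).
Proof. by split=> [a k x y|x]; [rewrite linearP|apply: rapp_linear]. Qed.

Definition tcat : {linear tens T W -> T} :=
  locked_with (lock_key 9) (blift cat_bilinear).

Lemma tcatE x a : tcat (tpair x a) = rapp a x.
Proof. by rewrite /tcat unlock bliftE. Qed.

(** The length filtration of T(W): maps on T(W) are constructed, compared and
    inverted along it. *)
Inductive short (m : nat) : T -> Prop :=
| short_nil : short m 0
| short_lin k x y : short m x -> short m y -> short m (k *: x + y)
| short_word w : (size w <= m)%N -> short m (word w).

Lemma short0 x : short 0 x -> x = 0.
Proof.
elim=> [//|k y z _ -> _ ->|[|//] _]; first by rewrite scaler0 addr0.
exact: word_nil.
Qed.

Lemma shortS m m' x : (m <= m')%N -> short m x -> short m' x.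
Proof.
move=> mm; elim=> [|k y z _ IHy _ IHz|w wm]; first exact: short_nil.
  exact: short_lin.
by apply: short_word; apply: leq_trans mm.
Qed.

Lemma short_ex x : exists m, short m x.
Proof.
elim/word_ind: x => [|k x y [p xp] [q yq]|w]; first by exists 0%N; apply: short_nil.
  exists (maxn p q); apply: short_lin; [apply: shortS xp|apply: shortS yq].
    exact: leq_maxl.
  exact: leq_maxr.
by exists (size w); apply: short_word.
Qed.

Lemma shortD m x y : short m x -> short m y -> short m (x + y).
Proof. by rewrite -{2}[x]scale1r; apply: short_lin. Qed.

Lemma short_rapp m a x : short m x -> short m.+1 (rapp a x).
Proof.
elim=> [|k y z _ IHy _ IHz|[|b w] wm]; first by rewrite linear0; apply: short_nil.
- by rewrite linearP; apply: short_lin.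
- by rewrite word_nil linear0; apply: short_nil.
by rewrite rappE; apply: short_word; rewrite size_rcons.
Qed.

Lemma short_inc m a : short m.+1 (inc a).
Proof. by rewrite incE; apply: short_word. Qed.

Lemma hsum_ind_size (U : lmodType K) (P : U -> Prop) (phi : seq (G * W) -> U) w :
  P 0 -> (forall u v : U, P u -> P v -> P (u + v)) ->
  (forall h, hhomog h -> size h = size w -> P (phi h)) -> P (hsum phi w).
Proof.
move=> P0 PD; elim: w phi => [|x w IHw] phi Pphi /=; first exact: Pphi.
apply: big_ind => // a _; apply: IHw => h hh hw; apply: Pphi => [y|/=]; last by rewrite hw.
by rewrite inE => /predU1P[->|/hh//]; rewrite /homog /= gpr_id.
Qed.

Lemma short_hind m (P : T -> Prop) :
  P 0 -> (forall k x y, P x -> P y -> P (k *: x + y)) ->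
  (forall h, hhomog h -> (size h <= m)%N -> P (word (map snd h))) ->
  forall x, short m x -> P x.
Proof.
move=> P0 Plin Ph x; elim=> // [k y z _ Py _ Pz|w wm]; first exact: Plin.
rewrite -(hsum_map _ (@word_multilinear K W)); apply: hsum_ind_size => // [y z Py Pz|h hh hw].
  by rewrite -[y]scale1r; apply: Plin.
by apply: Ph => //; rewrite hw.
Qed.

Lemma homog_word h : hhomog h -> homog (V := T) (hdeg h) (word (map snd h)).
Proof. by move=> hh; rewrite /homog /= tgprE // eqxx. Qed.

Definition swap_fun x y : tens T T :=
  \sum_(d <- gsupp x) tpair (ksign d y) (gpr d x).

Lemma swap_bilinear : bilinear_fun swap_fun.
Proof.
split=> [y k x x'|x k y y'].
  apply: (@gsupp_lin _ _ T _ (fun d z => tpair (ksign d y) z)) => d l z z'.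
  by rewrite tpairDr tpairZr.
rewrite /swap_fun scaler_sumr -big_split /=; apply: eq_bigr => d _.
by rewrite linearP tpairDl tpairZl.
Qed.

(** The signed flip x (x) y |-> (-1)^<x, y> y (x) x. *)
Definition swap : {linear tens T T -> tens T T} :=
  locked_with (lock_key 10) (blift swap_bilinear).

Lemma swapE d x y : homog d x -> swap (tpair x y) = tpair (ksign d y) x.
Proof.
move=> xd; rewrite /swap unlock bliftE /swap_fun.
rewrite (@big_homog _ _ T _ (fun d z => tpair (ksign d y) z) d) // => e.
by rewrite tpair0r.
Qed.

Lemma swapEh d e x y : homog d x -> homog e y ->
  swap (tpair x y) = ksgn K (dotp d e) *: tpair y x.
Proof. by move=> xd ye; rewrite (swapE _ xd) (ksignE _ ye) tpairZl. Qed.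

(** Contains the coproduct of a homogeneous word of degree d and length m. This is
    all that is used about the individual terms of the coproduct once its recursion
    is known. *)
Inductive bispan (d : G) (m : nat) : tens T T -> Prop :=
| bispan0 : bispan d m 0
| bispan_lin k (z z' : tens T T) :
    bispan d m z -> bispan d m z' -> bispan d m (k *: z + z')
| bispan_pair h h' : hhomog h -> hhomog h' -> (0 < size h)%N -> (0 < size h')%N ->
    (size h + size h')%N = m -> hdeg h + hdeg h' = d ->
    bispan d m (tpair (word (map snd h) : T) (word (map snd h') : T)).

Definition cop : {linear T -> tens T T} := locked_with (lock_key 11) (coproduct W).

Lemma copE h : hhomog h -> cop (word (map snd h)) = hcop h.
Proof. by move=> hh; rewrite /cop unlock coproductE. Qed.

(** The symmetrized coproduct: the sum over all splittings of a word into two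
    nonempty subwords, with no condition on where the last letter goes. *)
Definition bicop : {linear T -> tens T T} :=
  locked_with (lock_key 12) (cop \+ (swap \o cop) : {linear T -> tens T T}).

Lemma bicopE x : bicop x = cop x + swap (cop x).
Proof. by rewrite /bicop unlock. Qed.

End TensorCoalgebra.

Section SubsetsOfSuccessor.
Variable m : nat.

(** Each term of the coproduct of a longer word is indexed by such a pair: a subset
    of the positions of the shorter word, and the side on which its last letter
    goes. *)
Definition emb (b : bool) (I : {set 'I_m}) : {set 'I_m.+1} :=
  [set i | if unlift ord_max i is Some j then j \in I else b].

Let wd := widen_ord (leqnSn m).

Lemma emb_widen b I i : (wd i \in emb b I) = (i \in I).
Proof.
rewrite inE (_ : wd i = lift ord_max i) ?liftK //.
by apply: val_inj; rewrite [RHS]lift_max.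
Qed.
Lemma emb_max b I : (ord_max \in emb b I) = b.
Proof. by rewrite inE unlift_none. Qed.

Lemma ordSr_ind (P : 'I_m.+1 -> Prop) : (forall i, P (wd i)) -> P ord_max -> forall i, P i.
Proof.
move=> Pw Pm i; case: (unliftP ord_max i) => [j|] -> //.
by rewrite (_ : lift _ _ = wd j) //; apply: val_inj; rewrite [LHS]lift_max.
Qed.

Lemma embC b I : ~: emb b I = emb (~~ b) (~: I).
Proof.
by apply/setP; elim/ordSr_ind => [i|]; rewrite in_setC ?emb_widen ?emb_max ?in_setC.
Qed.

Lemma emb_bij : bijective (fun p : bool * {set 'I_m} => emb p.1 p.2).
Proof.
exists (fun I : {set 'I_m.+1} => (ord_max \in I, [set i | wd i \in I])) => [[b I]|I] /=.
  by rewrite emb_max; congr (_, _); apply/setP => i; rewrite inE emb_widen.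
by apply/setP; elim/ordSr_ind => [i|]; rewrite ?emb_widen ?emb_max ?inE.
Qed.

Lemma enum_emb b I :
  enum (emb b I) = map wd (enum I) ++ (if b then [:: ord_max] else [::]).
Proof.
rewrite /enum_mem -!enumT enum_ordSr filter_rcons filter_map.
rewrite (eq_filter (a2 := mem I)); last by move=> i; apply: emb_widen.
by rewrite [_ ord_max](emb_max b I); case: b; rewrite ?cats1 ?cats0.
Qed.

Lemma big_emb (R : nmodType) b I (F : 'I_m.+1 -> R) :
  \sum_(i in emb b I) F i = \sum_(i in I) F (wd i) + (if b then F ord_max else 0).
Proof.
rewrite big_mkcond big_ord_recr /= [X in _ = X + _]big_mkcond; congr (_ + _).
  by apply: eq_bigr => i _; rewrite emb_widen.
by rewrite emb_max.
Qed.

Lemma emb0 b I : (emb b I == set0) = ~~ b && (I == set0).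
Proof.
apply/eqP/andP => [e|[nb /eqP->]].
  split; first by rewrite -(emb_max b I) e inE.
  by apply/eqP/setP => i; rewrite -(emb_widen b I) e !inE.
by apply/setP; elim/ordSr_ind => [i|]; rewrite ?emb_widen ?emb_max ?inE //; case: b nb.
Qed.
End SubsetsOfSuccessor.

(** * The coproduct of a word with one more letter *)

Section RecursionForTheCoproduct.
Variables (K : fieldType) (n : nat) (W : gradedSpace K n).
Local Notation T := (tcoalg W).
Local Notation G := 'rV[int]_n.
Local Notation h0 := ((0, 0) : G * W).
Implicit Types (h : seq (G * W)).

Lemma bispanZ d m k z : bispan (W := W) d m z -> bispan d m (k *: z).
Proof. by move=> dz; rewrite -[_ *: _]addr0; apply: bispan_lin => //; apply: bispan0. Qed.

Lemma bispanD d m z z' : bispan (W := W) d m z -> bispan d m z' -> bispan d m (z + z').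
Proof. by move=> dz dz'; rewrite -[z]scale1r; apply: bispan_lin. Qed.

Lemma bispan_swap d m z : bispan (W := W) d m z -> bispan d m (swap W z).
Proof.
elim=> [|k x y _ IHx _ IHy|h h' hh hh' s0 s0' sm hd].
- by rewrite linear0; apply: bispan0.
- by rewrite linearP; apply: bispan_lin.
rewrite (swapEh (homog_word hh) (homog_word hh')); apply: bispanZ.
by apply: bispan_pair; rewrite // 1?addnC 1?addrC.
Qed.

Lemma hhomog_rcons h z : hhomog (V := W) (rcons h z) <-> hhomog h /\ homog z.1 z.2.
Proof.
split=> [hz|[hh hz] x]; last by rewrite mem_rcons inE => /predU1P[->|/hh].
by split=> [x xh|]; apply: hz; rewrite mem_rcons inE ?eqxx ?xh ?orbT.
Qed.

Lemma hdeg_rcons h z : hdeg (V := W) (rcons h z) = hdeg h + z.1.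
Proof. by rewrite /hdeg -cats1 big_cat big_seq1. Qed.

Lemma bispan_rapp d m z (a : G * W) : homog a.1 a.2 -> bispan (W := W) d m z ->
  bispan (d + a.1) m.+1 (tmap idfun (rapp a.2) z).
Proof.
move=> ha; elim=> [|k x y _ IHx _ IHy|h h' hh hh' s0 s0' sm hd].
- by rewrite linear0; apply: bispan0.
- by rewrite linearP; apply: bispan_lin.
rewrite tmapE /= rapp_word -?size_eq0 ?size_map -?lt0n // -map_rcons.
apply: bispan_pair; rewrite ?size_rcons ?addnS ?sm //.
  by apply/hhomog_rcons.
by rewrite hdeg_rcons addrA hd.
Qed.

Section Step.
Variables (h : seq (G * W)) (z : G * W) (m : nat).
Hypotheses (hh : hhomog h) (hm : size h = m.+1).

Let hp (I : {set 'I_m}) : seq (G * W) := [seq nth h0 h i | i : 'I_m <- enum I].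

Let lt_h (i : 'I_m) : (i < size h)%N.
Proof. by rewrite hm ltnS ltnW. Qed.

Lemma hp_homog I : hhomog (hp I).
Proof. by move=> x /mapP[i _ ->]; apply: hh; apply: mem_nth. Qed.

Lemma hsub_hp I : hsub h I = map snd (hp I).
Proof. by rewrite /hsub -map_comp. Qed.

Let last_h := last h0 h.

Lemma nth_max : nth h0 h m = last_h.
Proof. by rewrite /last_h -nth_last hm. Qed.

Lemma hsub_emb b I : hsub (m := m.+1) (rcons h z) (emb b I) =
  map snd (if b then rcons (hp I) last_h else hp I).
Proof.
rewrite /hsub enum_emb map_cat -map_comp.
have -> : map ((fun i : 'I_m.+1 => (nth h0 (rcons h z) i).2) \o widen_ord (leqnSn m)) (enum I)
          = map snd (hp I).
  by rewrite /hp -[RHS]map_comp; apply: eq_map => i /=; rewrite nth_rcons lt_h.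
case: b; last by rewrite cats0.
by rewrite /= cats1 map_rcons nth_rcons hm ltnSn -nth_max.
Qed.

Lemma last_hp_homog I : hhomog (rcons (hp I) last_h).
Proof.
apply/hhomog_rcons; split; first exact: hp_homog.
by apply: hh; rewrite -nth_max mem_nth // hm.
Qed.

Let D (i : 'I_m) := (nth h0 h i).1.

Lemma hdeg_hp I : hdeg (hp I) = \sum_(i in I) D i.
Proof. by rewrite /hdeg big_map big_enum. Qed.

Lemma koszul_emb_false I : koszul (m := m.+1) (rcons h z) (emb false I) = koszul h I.
Proof.
rewrite /koszul big_emb addr0; apply: eq_bigr => i _.
rewrite embC /= big_mkcondr big_emb /= ltnNge ltnW // addr0 -big_mkcondr.
by apply: eq_bigr => j _; rewrite !nth_rcons !lt_h.
Qed.

Lemma koszul_emb_true I : koszul (m := m.+1) (rcons h z) (emb true I) =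
  koszul h I + dotp last_h.1 (hdeg (hp (~: I))).
Proof.
rewrite /koszul big_emb; congr (_ + _).
  apply: eq_bigr => i _; rewrite embC /= big_mkcondr big_emb /= addr0 -big_mkcondr.
  by apply: eq_bigr => j _; rewrite !nth_rcons !lt_h.
rewrite embC /= big_mkcondr big_emb /= addr0 hdeg_hp [dotp last_h.1 _]dotpC dotp_suml.
apply: eq_bigr => j _; rewrite ltn_ord !nth_rcons lt_h hm ltnSn dotpC.
by rewrite nth_max.
Qed.

(** When the last letter of the shorter word goes to the left, its term is the
    flip of the term in which the two sides are exchanged: the inversions between
    the complement and I are the pairs that are not inversions between I and the
    complement, and the sign of the flip counts all pairs. *)
Lemma koszul_swap I : ksgn K (koszul (m := m.+1) (rcons h z) (emb true I)) =
  ksgn K (koszul h (~: I)) * ksgn K (dotp (hdeg (hp (~: I))) (hdeg (rcons (hp I) last_h))).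
Proof.
rewrite koszul_emb_true hdeg_rcons dotpDr !ksgnD mulrA (dotpC last_h.1); congr (_ * _).
rewrite -ksgnD !hdeg_hp; have -> : dotp (\sum_(j in ~: I) D j) (\sum_(i in I) D i) =
    koszul h (~: I) + koszul h I.
  rewrite dotp_suml /koszul setCK [X in _ = _ + X](exchange_big_dep (mem (~: I))) /=; last first.
    by move=> i j _ /andP[].
  rewrite -big_split /=; apply: eq_bigr => j jI.
  rewrite dotpC dotp_suml (bigID (fun i : 'I_m => (i < j)%N)) /=; congr (_ + _).
    by apply: eq_bigr => i _; rewrite dotpC.
  apply: eq_bigl => i; rewrite jI -leqNgt leq_eqVlt /=.
  case: (eqVneq (j : nat) i) => [/val_inj ji|//].
  by rewrite -ji (negPf (_ : j \notin I)) // -in_setC.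
by rewrite addrA !ksgnD ksgnM mul1r.
Qed.

Let cop_term (I : {set 'I_m}) : tens T T := ksgn K (koszul h I) *:
  tpair (word (map snd (hp I)) : T) (word (map snd (rcons (hp (~: I)) last_h)) : T).

Let cop_term' (I : {set 'I_m.+1}) : tens T T := ksgn K (koszul (rcons h z) I) *:
  tpair (word (hsub (rcons h z) I) : T) (word (rcons (hsub (rcons h z) (~: I)) z.2) : T).

Lemma hcop_terms : hcop h = \sum_(I | I != set0) cop_term I.
Proof.
rewrite /hcop hm; apply: eq_bigr => I _; rewrite /cop_term.
by rewrite !hsub_hp map_rcons.
Qed.

Lemma cop_term_false I : cop_term' (emb false I) = tmap idfun (rapp z.2) (cop_term I).
Proof.
rewrite /cop_term' koszul_emb_false hsub_emb embC hsub_emb linearZ tmapE /=.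
by rewrite rapp_word // map_rcons; case: map.
Qed.

Lemma cop_term_true I : I != setT ->
  cop_term' (emb true I) = tmap idfun (rapp z.2) (swap W (cop_term (~: I))).
Proof.
move=> IT; rewrite /cop_term' koszul_swap hsub_emb embC hsub_emb /=.
rewrite /cop_term [swap W _]linearZ setCK /=.
rewrite (swapEh (homog_word (@hp_homog _)) (homog_word (@last_hp_homog _))).
rewrite scalerA linearZ tmapE /= rapp_word //.
have [i iI] : exists i, i \in ~: I by apply/set0Pn; rewrite -setCT (inj_eq (@setC_inj _)).
rewrite /hp -size_eq0 !size_map -cardE.
by rewrite cards_eq0; apply/set0Pn; exists i.
Qed.

Lemma cop_term_full : cop_term' (emb true setT) =
  tpair (word (map snd h) : T) (word [:: z.2] : T).
Proof.
rewrite /cop_term' koszul_emb_true hsub_emb embC hsub_emb /= setCT /hp enum_set0 /=.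
have -> : koszul h [set: 'I_m] = 0.
  by apply: big1 => i _; apply: big1 => j; rewrite !inE.
rewrite /hdeg big_nil dotp0 addr0 scale1r; congr (tpair (word (map snd _)) _).
rewrite enum_setT -enumT; apply: (@eq_from_nth _ h0) => [|i].
  by rewrite size_rcons size_map size_enum_ord.
rewrite size_rcons size_map size_enum_ord ltnS nth_rcons size_map size_enum_ord => im.
case: ltnP => mi; first by rewrite (nth_map (Ordinal mi)) ?size_enum_ord // nth_enum_ord.
have -> : i = m by apply/eqP; rewrite eqn_leq im mi.
by rewrite eqxx /last_h -nth_last hm.
Qed.

(** The new letter z always ends the right factor. If it is alone there, the left
    factor is all of h. Otherwise the last letter of h lies either on the right,
    which gives a term of the coproduct of h, or on the left, which gives the
    flip of such a term. *)
Lemma hcop_rcons : hcop (rcons h z) =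
  tpair (word (map snd h) : T) (word [:: z.2] : T)
  + tmap idfun (rapp z.2) (hcop h + swap W (hcop h)).
Proof.
have -> : hcop (rcons h z) = \sum_(I | I != set0) cop_term' I.
  by rewrite /hcop size_rcons hm /hcop_ last_rcons.
rewrite (reindex _ (onW_bij _ (emb_bij m))) /=.
rewrite -(pair_big_dep xpredT (fun b I => emb b I != set0)
  (fun b I => cop_term' (emb b I))) /= big_bool /= hcop_terms linearD !linear_sum /=.
rewrite [RHS]addrCA addrC; congr (_ + _).
  by apply: eq_big => [I|I _]; rewrite ?emb0 // cop_term_false.
rewrite (bigD1 setT) ?emb0 //= cop_term_full; congr (_ + _).
rewrite [RHS](reindex_inj (@setC_inj _)); apply: eq_big => [I|I /andP[_ IT]].
  by rewrite emb0 /= -setCT (inj_eq (@setC_inj _)).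
by rewrite cop_term_true // linear_sum.
Qed.
End Step.
End RecursionForTheCoproduct.

(** * The co-Zinbiel identity *)

Section CoZinbiel.
Variables (K : fieldType) (n : nat) (W : gradedSpace K n).
Local Notation T := (tcoalg W).
Local Notation G := 'rV[int]_n.
Implicit Types (w : seq W) (h : seq (G * W)).

Lemma gradedSpace_ind (V : gradedSpace K n) (P : V -> Prop) :
  P 0 -> (forall u v : V, P u -> P v -> P (u + v)) ->
  (forall d (u : V), homog d u -> P u) -> forall u, P u.
Proof.
move=> P0 PD Ph x; rewrite [x]gsuppE; apply: big_ind => // d _.
by apply: (Ph d); rewrite /homog gpr_id.
Qed.

Lemma hcop1 (z : G * W) : hcop [:: z] = 0.
Proof.
by rewrite /hcop /hcop_ big_pred0 // => I; apply/negbTE/negPn/eqP/setP => -[].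
Qed.

Lemma cop_inc a : cop W (inc W a) = 0.
Proof.
elim/gradedSpace_ind: a => [|a b IHa IHb|d a ad]; first by rewrite !linear0.
  by rewrite !linearD /= IHa IHb addr0.
rewrite incE (copE (h := [:: (d, a)])) ?hcop1 // => x; rewrite inE => /eqP-> //.
Qed.

Lemma concat_ind (P : T -> Prop) :
  P 0 -> (forall k x y, P x -> P y -> P (k *: x + y)) ->
  (forall a, P (inc W a)) ->
  (forall a w, w != [::] -> P (word w) -> P (rapp a (word w : T))) -> forall x, P x.
Proof.
move=> P0 Pl Pi Pr; apply: word_ind => // w.
elim/last_ind: w => [|w a IHw]; first by rewrite word_nil.
have [->|w0] := eqVneq w [::]; first by rewrite /= -incE.
by rewrite -rapp_word //; apply: Pr.
Qed.

(** The recursion for the coproduct, freed of homogeneity by linearity in the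
    letter and in the word. *)
Lemma cop_rapp a y :
  cop W (rapp a y) = tpair y (inc W a) + tmap idfun (rapp a) (bicop W y).
Proof.
elim/gradedSpace_ind: a => [|a b IHa IHb|d a ad].
- rewrite (lin0 (rapp_linear y)) !linear0 tpair0r tmap0r ?addr0 // => x.
  exact: (lin0 (rapp_linear x)).
- have rD x : rapp (a + b) x = rapp a x + rapp b x.
    by have := rapp_linear x 1 a b; rewrite !scale1r.
  have -> : tmap idfun (rapp (a + b)) (bicop W y) =
     tmap idfun (rapp a) (bicop W y) + tmap idfun (rapp b) (bicop W y).
    by rewrite -tmapDr; apply: eq_tmap.
  by rewrite rD [LHS]linearD /= IHa IHb [inc W (a + b)]linearD /= tpairDr addrACA.
elim/hword_ind: y => [|k x y IHx IHy|h hh].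
- by rewrite !linear0 tpair0l addr0.
- by rewrite !linearP IHx IHy tpairDl tpairZl scalerDr addrACA.
case: h hh => [|z h] hh.
  by rewrite /= word_nil !linear0 tpair0l addr0.
rewrite rapp_word // -(map_rcons snd _ (d, a)).
rewrite copE; last by apply/hhomog_rcons.
by rewrite (hcop_rcons (m := size h) (d, a) hh) // incE bicopE copE.
Qed.

Lemma bispan_cop h : hhomog h ->
  bispan (hdeg h) (size h) (cop W (word (map snd h))).
Proof.
elim/last_ind: h => [|h z IHh] hh; first by rewrite word_nil linear0; apply: bispan0.
have [{}hh hz] := (hhomog_rcons h z).1 hh.
case: (posnP (size h)) => [/size0nil ->|h0].
  by rewrite /= -incE cop_inc; apply: bispan0.
rewrite map_rcons -rapp_word -?size_eq0 ?size_map -?lt0n // cop_rapp.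
rewrite hdeg_rcons size_rcons; apply: bispanD.
  rewrite incE -[[:: _]]/(map snd [:: z]).
  apply: bispan_pair => //; rewrite ?addn1 //; last by rewrite /hdeg big_seq1.
  by move=> x; rewrite inE => /eqP->.
apply: bispan_rapp => //; rewrite bicopE; apply: bispanD; first exact: IHh.
exact/bispan_swap/IHh.
Qed.

Lemma proj_rapp a y : proj W (rapp a y) = 0.
Proof.
elim/word_ind: y => [|k x y IHx IHy|w]; first by rewrite !linear0.
  by rewrite !linearP IHx IHy scaler0 addr0.
case: w => [|b w]; first by rewrite word_nil !linear0.
by rewrite rappE projE; case: w.
Qed.

(** In the coproduct of a word, the right factor is a single letter only when the
    left factor is everything but the last letter. *)
Lemma reconstruct x : x = inc W (proj W x) + tcat W (tmap idfun (proj W) (cop W x)).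
Proof.
elim/concat_ind: x => [|k x y IHx IHy|a|a w _ _]; first by rewrite !linear0 addr0.
- by rewrite !linearP {1}IHx {1}IHy scalerDr addrACA.
- by rewrite proj_inc cop_inc !linear0 addr0.
rewrite proj_rapp cop_rapp !linearD /= tmap_comp tmapE proj_inc tcatE linear0 add0r.
rewrite tmap0r ?linear0 ?addr0 // => y; exact: proj_rapp.
Qed.

Lemma tens_hext (A B : gradedSpace K n) (U : lmodType K) (f g : {linear tens A B -> U}) :
  (forall d e a b, homog d a -> homog e b -> f (tpair a b) = g (tpair a b)) -> f =1 g.
Proof.
move=> fg; apply: tens_ext => a b.
elim/gradedSpace_ind: a => [|a a' IHa IHb|d a ad]; first by rewrite tpair0l !linear0.
  by rewrite tpairDl !linearD /= IHa IHb.
elim/gradedSpace_ind: b => [|b b' IHb IHb'|e b be]; first by rewrite tpair0r !linear0.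
  by rewrite tpairDr !linearD /= IHb IHb'.
exact: fg ad be.
Qed.

Lemma tens3_hext (A B C : gradedSpace K n) (U : lmodType K)
    (f g : {linear tens A (tens B C) -> U}) :
  (forall d e i a b c, homog d a -> homog e b -> homog i c ->
     f (tpair a (tpair b c)) = g (tpair a (tpair b c))) -> f =1 g.
Proof.
move=> fg; apply: tens3_ext => a b c.
elim/gradedSpace_ind: a => [|a a' IHa IHb|d a ad]; first by rewrite tpair0l !linear0.
  by rewrite tpairDl !linearD /= IHa IHb.
elim/gradedSpace_ind: b => [|b b' IHb IHb'|e b be]; first by rewrite tpair0l tpair0r !linear0.
  by rewrite tpairDl tpairDr !linearD /= IHb IHb'.
elim/gradedSpace_ind: c => [|c c' IHc IHc'|i c ci]; first by rewrite !tpair0r !linear0.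
  by rewrite !tpairDr !linearD /= IHc IHc'.
exact: fg ad be ci.
Qed.

(** The two generators of the signed action of the symmetric group on threefold
    tensors. *)
Definition swap12 : {linear tens T (tens T T) -> tens T (tens T T)} :=
  locked_with (lock_key 13) (assoc \o (tmap (swap W) idfun \o unassoc)
    : {linear tens T (tens T T) -> tens T (tens T T)}).
Definition swap23 : {linear tens T (tens T T) -> tens T (tens T T)} :=
  locked_with (lock_key 14) (tmap idfun (swap W)).

Lemma swap12E d e (a b c : T) : homog d a -> homog e b ->
  swap12 (tpair a (tpair b c)) = ksgn K (dotp d e) *: tpair b (tpair a c).
Proof.
move=> ad be; rewrite /swap12 unlock /= unassocE tmapE (swapEh ad be) /=.
by rewrite tpairZl linearZ /= assocE.
Qed.

Lemma swap23E e i (a b c : T) : homog e b -> homog i c ->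
  swap23 (tpair a (tpair b c)) = ksgn K (dotp e i) *: tpair a (tpair c b).
Proof. by move=> be ci; rewrite /swap23 unlock tmapE (swapEh be ci) tpairZr. Qed.

Lemma swap12K : involutive swap12.
Proof.
apply: (@tens3_hext _ _ _ _ (swap12 \o swap12) idfun) => d e i a b c ad be ci /=.
by rewrite (swap12E _ ad be) linearZ /= (swap12E _ be ad) scalerA dotpC ksgnM scale1r.
Qed.

Lemma braid x : swap12 (swap23 (swap12 x)) = swap23 (swap12 (swap23 x)).
Proof.
move: x; apply: (@tens3_hext _ _ _ _ (swap12 \o (swap23 \o swap12)) (swap23 \o (swap12 \o swap23)))
  => d e i a b c ad be ci /=.
rewrite (swap12E _ ad be) (swap23E _ be ci) !linearZ /= (swap23E _ ad ci) (swap12E _ ad ci) !linearZ /=.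
rewrite (swap12E _ be ci) (swap23E _ ad be) !scalerA; congr (_ *: _).
exact: mulrAC.
Qed.

Lemma cop_swap_r z : tmap idfun (cop W) (swap W z) =
  swap12 (swap23 (assoc (tmap (cop W) idfun z))).
Proof.
move: z; apply: (@tens_hext _ _ _ (tmap idfun (cop W) \o swap W)
  (swap12 \o (swap23 \o (assoc \o tmap (cop W) idfun)))) => d e a b _ be /=.
elim/hword_ind: a => [|k x y IHx IHy|h hh].
- by rewrite tpair0l !linear0.
- by rewrite tpairDl tpairZl !linearP IHx IHy.
rewrite (swapEh (homog_word hh) be) linearZ /= !tmapE /=.
elim: (bispan_cop hh) => [|k x y _ IHx _ IHy|h1 h2 hh1 hh2 _ _ _ hd].
- by rewrite tpair0l tpair0r !linear0 ?scaler0.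
- by rewrite tpairDl tpairDr tpairZl tpairZr !linearP -IHx -IHy.
rewrite assocE (swap23E _ (homog_word hh2) be) linearZ /=.
rewrite (swap12E _ (homog_word hh1) be) scalerA -ksgnD -hd dotpDl.
by rewrite addrC.
Qed.

Lemma cop_swap_l z : assoc (tmap (cop W) idfun (swap W z)) =
  swap23 (swap12 (tmap idfun (cop W) z)).
Proof.
move: z; apply: (@tens_hext _ _ _ (assoc \o (tmap (cop W) idfun \o swap W))
  (swap23 \o (swap12 \o tmap idfun (cop W)))) => d e a b ad _ /=.
elim/hword_ind: b => [|k x y IHx IHy|h hh].
- by rewrite tpair0r !linear0.
- by rewrite tpairDr tpairZr !linearP IHx IHy.
rewrite (swapEh ad (homog_word hh)) !linearZ /= !tmapE /=.
elim: (bispan_cop hh) => [|k x y _ IHx _ IHy|h1 h2 hh1 hh2 _ _ _ hd].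
- by rewrite tpair0l tpair0r !linear0 ?scaler0.
- by rewrite tpairDl tpairDr tpairZl tpairZr !linearP -IHx -IHy.
rewrite assocE (swap12E _ ad (homog_word hh1)) linearZ /=.
by rewrite (swap23E _ ad (homog_word hh2)) scalerA -ksgnD -hd dotpDr.
Qed.

Lemma swap_cop_l z : assoc (tmap (swap W \o cop W) idfun z) =
  swap12 (assoc (tmap (cop W) idfun z)).
Proof.
move: z; apply: (@tens_ext _ _ _ _ (assoc \o tmap (swap W \o cop W) idfun)
  (swap12 \o (assoc \o tmap (cop W) idfun))) => x y /=.
by rewrite !tmapE /= /swap12 unlock /= (@unassocK _ T T T) tmapE.
Qed.

Lemma bicop_r z :
  tmap idfun (bicop W) z = tmap idfun (cop W) z + swap23 (tmap idfun (cop W) z).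
Proof.
move: z; apply: (@tens_ext _ _ _ _ _ (tmap idfun (cop W) \+ (swap23 \o tmap idfun (cop W)))).
by move=> x y /=; rewrite !tmapE /swap23 unlock tmapE bicopE tpairDr.
Qed.

Lemma bicop_l z : assoc (tmap (bicop W) idfun z) =
  assoc (tmap (cop W) idfun z) + swap12 (assoc (tmap (cop W) idfun z)).
Proof.
rewrite -swap_cop_l; move: z; apply: (@tens_ext _ _ _ _ (assoc \o tmap (bicop W) idfun)
  ((assoc \o tmap (cop W) idfun) \+ (assoc \o tmap (swap W \o cop W) idfun))).
by move=> x y /=; rewrite !tmapE bicopE tpairDl linearD.
Qed.

(** The co-Zinbiel identity at y gives the coassociativity of the symmetrized
    coproduct at y: with Y = (D (x) 1) D y, both sides are the sum of the six
    signed permutations of Y. *)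
Lemma coassoc y :
  tmap idfun (cop W) (cop W y) = assoc (tmap (bicop W) idfun (cop W y)) ->
  tmap idfun (bicop W) (bicop W y) = assoc (tmap (bicop W) idfun (bicop W y)).
Proof.
rewrite bicop_l => coZ.
rewrite bicop_r bicop_l bicopE !linearD /= cop_swap_r cop_swap_l coZ.
set Y := assoc _; rewrite !linearD /= swap12K braid.
(* By the braid relation, both sides now list the same six permutations of Y. *)
by rewrite [RHS](AC ((1*2)*(1*2)) ((1*4*6)*(3*2*5))).
Qed.

(** Dual of the Zinbiel identity a (b c) = (a b + b a) c of the half-shuffle
    product. By the recursion for the coproduct, the identity for a longer word
    is the coassociativity of the symmetrized coproduct for the shorter one. *)
Lemma coZinbiel x :
  tmap idfun (cop W) (cop W x) = assoc (tmap (bicop W) idfun (cop W x)).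
Proof.
elim/concat_ind: x => [|k x y IHx IHy|a|a w _].
- by rewrite !linear0.
- by rewrite !linearP IHx IHy.
- by rewrite cop_inc !linear0.
move/coassoc; set y : T := word w => ca.
rewrite cop_rapp !linearD /= !tmapE /= cop_inc tpair0r add0r.
have rE z : tmap idfun (cop W) (tmap idfun (rapp a) z) =
    assoc (tpair z (inc W a)) + tmap idfun (tmap idfun (rapp a)) (tmap idfun (bicop W) z).
  elim/tpair_ind: z => [|k z z' IHz IHz'|u v].
  - by rewrite tpair0l !linear0 addr0.
  - by rewrite tpairDl tpairZl !linearP IHz IHz' scalerDr addrACA.
  by rewrite !tmapE /= assocE cop_rapp tpairDr.
rewrite rE ca; congr (_ + _).
rewrite -assoc_tmap; congr (assoc _).
elim/tpair_ind: (bicop W y) => [|k z z' IHz IHz'|u v]; first by rewrite !linear0.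
  by rewrite !linearP IHz IHz'.
by rewrite !tmapE /= (@tmap_id _ T T).
Qed.
End CoZinbiel.

(** * Weights *)

Section Weights.
Variables (K : fieldType) (n : nat).
Implicit Types (V : gradedSpace K n).

Lemma homog0 V d : homog d (0 : V).
Proof. exact: linear0. Qed.

Lemma homog_lin V d k (x y : V) : homog d x -> homog d y -> homog d (k *: x + y).
Proof. by move=> dx dy; rewrite /homog gpr_linear dx dy. Qed.

Lemma homogD V d (x y : V) : homog d x -> homog d y -> homog d (x + y).
Proof. by rewrite -{2}[x]scale1r; apply: homog_lin. Qed.

Lemma homogZ V d k (x : V) : homog d x -> homog d (k *: x).
Proof. by move=> dx; rewrite -[_ *: _]addr0; apply: homog_lin => //; apply: homog0. Qed.

Lemma gprD V a (x y : V) : gpr a (x + y) = gpr a x + gpr a y.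
Proof. by have := gpr_linear a 1 x y; rewrite !scale1r. Qed.

Lemma homogB V d (x y : V) : homog d x -> homog d y -> homog d (x - y).
Proof. by move=> dx dy; rewrite -scaleN1r; apply/homogD/homogZ. Qed.

Lemma gpr_homog V d (x : V) a : homog d x -> gpr a x = if a == d then x else 0.
Proof. by move=> xd; rewrite -{1}xd gprK xd. Qed.

Lemma weight_gpr V V' c (f : {linear V -> V'}) : has_weight c f ->
  forall a x, f (gpr a x) = gpr (a + c) (f x).
Proof.
move=> fc a x; elim/gradedSpace_ind: x => [|x y IHx IHy|d x xd].
- by rewrite !linear0.
- by rewrite !linearD /= IHx IHy.
rewrite (gpr_homog _ xd) (gpr_homog _ (fc _ _ xd)) (inj_eq (addIr c)).
by case: ifP; rewrite ?linear0.
Qed.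

Lemma gpr_weight V V' c (f : {linear V -> V'}) :
  (forall a x, f (gpr a x) = gpr (a + c) (f x)) -> has_weight c f.
Proof. by move=> fc a x xa; rewrite /homog -fc xa. Qed.

Lemma weight_comp V V' V'' c c' (f : {linear V -> V'}) (g : {linear V' -> V''}) :
  has_weight c f -> has_weight c' g -> has_weight (c + c') (g \o f).
Proof. by move=> fc gc a x xa; rewrite addrA; apply/gc/fc. Qed.

Lemma weight_comp0 V V' V'' (f : {linear V -> V'}) (g : {linear V' -> V''}) :
  has_weight 0 f -> has_weight 0 g -> has_weight 0 (g \o f).
Proof. by move=> f0 g0; have := weight_comp f0 g0; rewrite addr0. Qed.

Lemma weight0 V V' (f : {linear V -> V'}) : has_weight 0 f ->
  forall d x, homog d x -> homog d (f x).
Proof. by move=> f0 d x xd; have := f0 _ _ xd; rewrite addr0. Qed.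

Lemma weight_ksign V V' c d (f : {linear V -> V'}) : has_weight c f ->
  forall x, ksign d (f x) = ksgn K (dotp d c) *: f (ksign d x).
Proof.
move=> fc; elim/gradedSpace_ind => [|x y IHx IHy|e x xe].
- by rewrite !linear0.
- by rewrite !linearD /= IHx IHy.
by rewrite (ksignE _ xe) (ksignE _ (fc _ _ xe)) dotpDr expfzDr ?oppr_eq0 ?oner_eq0 //
  linearZ /= scalerA mulrC.
Qed.

Lemma ksign_weight V c : has_weight 0 (@ksign K n V c).
Proof. by move=> d x xd; rewrite addr0 (ksignE _ xd); apply: homogZ. Qed.

Lemma ksign0 V (x : V) : ksign 0 x = x.
Proof.
rewrite [RHS]gsuppE /ksign; apply: eq_bigr => a _.
by rewrite dot0p scale1r.
Qed.

Lemma ksignD V c d (x : V) : ksign c (ksign d x) = ksign (c + d) x.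
Proof.
elim/gradedSpace_ind: x => [|x y IHx IHy|e x xe]; first by rewrite !linear0.
  by rewrite !linearD /= IHx IHy.
rewrite (ksignE _ xe) linearZ /= !(ksignE _ xe) scalerA.
by rewrite dotpDl mulrC -expfzDr // oppr_eq0 oner_eq0.
Qed.

Lemma ksignN V c (x : V) : ksign (- c) x = ksign c x.
Proof.
elim/gradedSpace_ind: x => [|x y IHx IHy|e x xe]; first by rewrite !linear0.
  by rewrite !linearD /= IHx IHy.
by rewrite !(ksignE _ xe) dotpNl; congr (_ *: _); apply: ksgnN.
Qed.

End Weights.

Section WeightsOnWords.
Variables (K : fieldType) (n : nat) (W W' : gradedSpace K n).
Local Notation T := (tcoalg W).
Local Notation T' := (tcoalg W').

Lemma tensmap_tmap (A : gradedSpace K n) (B A' B' : lmodType K) c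
    (f : {linear A -> A'}) (g : {linear B -> B'}) x :
  tensmap c f g x = tmap (f \o ksign c) g x.
Proof.
by move: x; apply: tens_ext => a b; rewrite bliftE tmapE.
Qed.

Lemma tensmap0 (A : gradedSpace K n) (B A' B' : lmodType K)
    (f : {linear A -> A'}) (g : {linear B -> B'}) x :
  tensmap 0 f g x = tmap f g x.
Proof. by rewrite tensmap_tmap; apply: eq_tmap => // a /=; rewrite ksign0. Qed.

Lemma weight_words (V : gradedSpace K n) c (F : {linear T -> V}) :
  (forall h, hhomog h -> homog (hdeg h + c) (F (word (map snd h)))) ->
  has_weight c F.
Proof.
move=> Fc; apply: gpr_weight => a; elim/hword_ind => [|k x y IHx IHy|h hh].
- by rewrite !linear0.
- by rewrite !linearP IHx IHy.
rewrite (gpr_homog _ (homog_word hh)) (gpr_homog _ (Fc h hh)) (inj_eq (addIr c)).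
by case: ifP; rewrite ?linear0.
Qed.

Lemma inc_weight : has_weight 0 (inc W).
Proof.
move=> d a ad; rewrite addr0 incE.
have := @homog_word _ _ W [:: (d, a)]; rewrite /hdeg big_seq1; apply.
by move=> x; rewrite inE => /eqP->.
Qed.

Lemma proj_weight : has_weight 0 (proj W).
Proof.
apply: weight_words => -[|z [|z' h]] hh; rewrite projE /= ?addr0; try exact: homog0.
by rewrite /hdeg big_seq1; apply: hh; rewrite inE.
Qed.

Lemma rapp_weight d (a : W) : homog d a -> has_weight d (rapp a).
Proof.
move=> ad; apply: weight_words => -[|z h] hh.
  by rewrite /= word_nil linear0; apply: homog0.
rewrite rapp_word // -(map_rcons snd _ (d, a)) -[X in homog X]/(hdeg _ + (d, a).1).
rewrite -hdeg_rcons; apply: homog_word; exact/hhomog_rcons.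
Qed.

(** Both factors of the coproduct of a word are strictly shorter than the word. *)
Lemma cop_agree m (U U' : lmodType K) (f f' : {linear T -> U}) (g g' : {linear T -> U'}) x :
  (forall y, short m y -> f y = f' y) -> (forall y, short m y -> g y = g' y) ->
  short m.+1 x -> tmap f g (cop W x) = tmap f' g' (cop W x).
Proof.
move=> ff gg; elim/short_hind => [|k y z IHy IHz|h hh hm]; first by rewrite !linear0.
  by rewrite !linearP IHy IHz.
elim: (bispan_cop hh) => [|k y z _ IHy _ IHz|h1 h2 _ _ s1 s2 s12 _]; first by rewrite !linear0.
  by rewrite !linearP IHy IHz.
by rewrite !tmapE ff ?gg //; apply: short_word; rewrite size_map; lia.
Qed.
End WeightsOnWords.

(** * Cohomomorphisms and their corestrictions *)

Section Corestrictions.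
Variables (K : fieldType) (n : nat) (W W' : gradedSpace K n).
Local Notation T := (tcoalg W).
Local Notation T' := (tcoalg W').

(** This is the uniqueness of a map with prescribed corestriction, for the
    equation satisfied both by the difference of two cohomomorphisms and by the
    difference of two coderivations along the same cohomomorphism. By
    [reconstruct], E on a word is computed from E on shorter words. *)
Lemma coder_eq0 (E A B : {linear T -> T'}) :
  (forall x, proj W' (E x) = 0) ->
  (forall x, cop W' (E x) = tmap E A (cop W x) + tmap B E (cop W x)) ->
  forall x, E x = 0.
Proof.
move=> pE cE x; have [m] := short_ex x; elim: m x => [|m IHm] x xm.
  by rewrite (short0 xm) linear0.
rewrite [LHS]reconstruct pE cE linear0 add0r !linearD /= !tmap_comp.
rewrite [X in _ + tcat _ X]tmap0r ?linear0 ?addr0 => [|y]; last exact: pE.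
have -> : tmap (idfun \o E) (proj W' \o A) (cop W x) = tmap \0 (proj W' \o A) (cop W x).
  by apply: (cop_agree (m := m)) => // y ym /=; rewrite IHm.
by rewrite tmap0l ?linear0.
Qed.

Lemma cohom_unique (F F' : {linear T -> T'}) :
  (forall x, cop W' (F x) = tmap F F (cop W x)) ->
  (forall x, cop W' (F' x) = tmap F' F' (cop W x)) ->
  (forall x, proj W' (F x) = proj W' (F' x)) -> F =1 F'.
Proof.
move=> cF cF' pF x; apply/eqP; rewrite -subr_eq0; apply/eqP.
apply: (@coder_eq0 (F \- F') F F') => {}x /=; first by rewrite linearB /= pF subrr.
rewrite linearB /= cF cF'; move: (cop W x).
apply: (@tens_ext _ _ _ _ (tmap F F \- tmap F' F')
  (tmap (F \- F') F \+ tmap F' (F \- F'))) => a b /=.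
by rewrite !tmapE /= tpairDl tpairDr -!scaleN1r tpairZl tpairZr !scaleN1r addrA subrK.
Qed.

Definition cohom (F : {linear T -> T'}) :=
  has_weight 0 F /\ forall x, cop W' (F x) = tmap F F (cop W x).

Section Recursion.
Variable f : {linear T -> W'}.

(** Approximations to the solution of F = f + cat (F (x) f) D; the k-th one is
    exact on words of length at most k. *)
Fixpoint cohom_step (k : nat) : {linear T -> T'} :=
  if k is k'.+1 then (inc W' \o f) \+ (tcat W' \o (tmap (cohom_step k') f \o cop W))
  else \0.

Lemma cohom_stepS k x :
  cohom_step k.+1 x = inc W' (f x) + tcat W' (tmap (cohom_step k) f (cop W x)).
Proof. by []. Qed.

Lemma cohom_step_stable m k x : short m x -> (m <= k)%N ->
  cohom_step k x = cohom_step m x.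
Proof.
elim: m k x => [|m IHm] [|k] x // xm; first by rewrite (short0 xm) !linear0.
rewrite ltnS => mk; rewrite !cohom_stepS; congr (_ + tcat W' _).
by apply: (cop_agree (m := m)) => // y ym; apply: IHm.
Qed.

Let phi (w : seq W) : T' := cohom_step (size w) (word w).

Lemma cohom_ext_multilinear : multilinear phi.
Proof.
move=> k a b u v; rewrite /phi !size_cat /=.
by rewrite word_multilinear linearP.
Qed.

Definition cohom_ext : {linear T -> T'} := locked_with (lock_key 20)
  (tlift (erefl (phi [::])) cohom_ext_multilinear : {linear tmod W -> T'}).

Lemma cohom_ext_step k x : short k x -> cohom_ext x = cohom_step k x.
Proof.
elim=> [|c y z _ IHy _ IHz|w wk]; first by rewrite !linear0.
  by rewrite !linearP IHy IHz.
rewrite /cohom_ext unlock tliftE (@cohom_step_stable (size w) k) //.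
exact: short_word.
Qed.

Lemma cohom_extE x :
  cohom_ext x = inc W' (f x) + tcat W' (tmap cohom_ext f (cop W x)).
Proof.
have [k xk] := short_ex x; rewrite (cohom_ext_step (shortS (leqnSn k) xk)) cohom_stepS.
congr (_ + tcat W' _); apply: (cop_agree (m := k)) => // [y yk|].
  by rewrite (cohom_ext_step yk).
exact: shortS xk.
Qed.

End Recursion.
End Corestrictions.

Section Concat.
Variables (K : fieldType) (n : nat) (W : gradedSpace K n).

Lemma cop_tcat z : cop W (tcat W z) =
  tmap idfun (inc W) z + tmap idfun (tcat W) (assoc (tmap (bicop W) idfun z)).
Proof.
move: z; apply: (@tens_ext _ _ _ _ (cop W \o tcat W) (tmap idfun (inc W) \+
  (tmap idfun (tcat W) \o (assoc \o tmap (bicop W) idfun)))) => y a /=.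
rewrite tcatE cop_rapp !tmapE /=; congr (_ + _).
elim/tpair_ind: (bicop W y) => [|k u v IHu IHv|u v].
- by rewrite tpair0l !linear0.
- by rewrite tpairDl tpairZl !linearP IHu IHv.
by rewrite assocE !tmapE tcatE.
Qed.

Lemma proj_tcat z : proj W (tcat W z) = 0.
Proof.
elim/tpair_ind: z => [|k x y IHx IHy|y a]; first by rewrite !linear0.
  by rewrite !linearP IHx IHy scaler0 addr0.
by rewrite tcatE proj_rapp.
Qed.
End Concat.

Section CoalgebraMaps.
Variables (K : fieldType) (n : nat) (W W' : gradedSpace K n).
Local Notation T := (tcoalg W).
Local Notation T' := (tcoalg W').

Lemma swap_weight0 (F : {linear T -> T'}) z : has_weight 0 F ->
  swap W' (tmap F F z) = tmap F F (swap W z).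
Proof.
move=> F0; move: z; apply: (@tens_hext _ _ _ _ _ (swap W' \o tmap F F) (tmap F F \o swap W))
  => d e a b ad be /=.
rewrite (swapEh ad be) linearZ /= !tmapE.
by rewrite (swapEh (weight0 F0 ad) (weight0 F0 be)).
Qed.

Lemma bicop_cohom (F : {linear T -> T'}) y : has_weight 0 F ->
  cop W' (F y) = tmap F F (cop W y) -> bicop W' (F y) = tmap F F (bicop W y).
Proof. by move=> F0 cF; rewrite !bicopE cF linearD /= swap_weight0. Qed.

(** By induction on the length, the coproduct of cat (F (x) f) D is given by the
    recursion for the coproduct, and the co-Zinbiel identity regroups it into
    (F (x) F) D, the second F being unfolded by its own recursion. *)
Lemma cohom_of_rec (F : {linear T -> T'}) (f : {linear T -> W'}) : has_weight 0 F ->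
  (forall x, F x = inc W' (f x) + tcat W' (tmap F f (cop W x))) -> cohom F.
Proof.
move=> F0 Frec; split=> // x; have [m] := short_ex x.
elim: m x => [|m IHm] x xm; first by rewrite (short0 xm) !linear0.
rewrite {1}Frec linearD /= cop_inc add0r cop_tcat !tmap_comp.
have -> : tmap (bicop W' \o F) (idfun \o f) (cop W x) =
          tmap (tmap F F \o bicop W) (f \o idfun) (cop W x).
  apply: (cop_agree (m := m)) => // y ym /=; apply: bicop_cohom => //; exact: IHm.
rewrite -(tmap_comp (bicop W) idfun (tmap F F) f) assoc_tmap -coZinbiel !tmap_comp.
elim/tpair_ind: (cop W x) => [|k y z IHy IHz|y z]; first by rewrite !linear0 addr0.
  by rewrite !linearP -IHy -IHz scalerDr addrACA.
by rewrite !tmapE /= -tpairDr -Frec.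
Qed.

Lemma cohom_ext_weight (f : {linear T -> W'}) : has_weight 0 f -> has_weight 0 (cohom_ext f).
Proof.
move=> f0; apply: weight_words => h hh; rewrite addr0.
have [m] := ubnP (size h); elim: m h hh => // m IHm h hh hm.
rewrite cohom_extE; apply: homogD.
  by rewrite -[hdeg h]addr0; apply/inc_weight/weight0/homog_word.
have : bispan (hdeg h) (size h) (cop W (word (map snd h))) by apply: bispan_cop.
elim=> [|k y z _ IHy _ IHz|h1 h2 hh1 hh2 s1 s2 s12 <-].
- by rewrite !linear0; apply: homog0.
- by rewrite !linearP; apply: homog_lin.
rewrite tmapE tcatE; apply: rapp_weight; first by apply/weight0/homog_word.
by apply: IHm => //; lia.
Qed.

Lemma cohom_extP (f : {linear T -> W'}) : has_weight 0 f -> cohom (cohom_ext f).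
Proof.
move=> f0; apply: cohom_of_rec (cohom_extE f); exact: cohom_ext_weight.
Qed.

Lemma proj_cohom_ext (f : {linear T -> W'}) x : proj W' (cohom_ext f x) = f x.
Proof. by rewrite cohom_extE linearD /= proj_inc proj_tcat addr0. Qed.

Lemma cohom_inc (F : {linear T -> T'}) a : cohom F ->
  F (inc W a) = inc W' (proj W' (F (inc W a))).
Proof.
by case=> _ cF; rewrite {1}[F _]reconstruct cF cop_inc !linear0 addr0.
Qed.

Section Functor.
Variable e : {linear W -> W'}.

Lemma tfun_multilinear : multilinear (fun w => word (map e w) : T').
Proof. by move=> k a b u v; rewrite !map_cat /= linearP word_multilinear. Qed.

(** The functor T. *)
Definition tfun : {linear T -> T'} := locked_with (lock_key 21)
  (@tlift K W T' (fun w => word (map e w) : T') (word_nil W') tfun_multilinear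
     : {linear tmod W -> T'}).

Lemma tfunE w : tfun (word w) = word (map e w).
Proof. by rewrite /tfun unlock tliftE. Qed.

Lemma tfun_inc a : tfun (inc W a) = inc W' (e a).
Proof. by rewrite !incE tfunE. Qed.

Lemma tfun_rapp a y : tfun (rapp a y) = rapp (e a) (tfun y).
Proof.
elim/word_ind: y => [|k x y IHx IHy|[|b w]]; first by rewrite !linear0.
- by rewrite !linearP IHx IHy.
- by rewrite word_nil !linear0.
by rewrite rappE !tfunE /= rappE map_rcons.
Qed.

Lemma proj_tfun x : proj W' (tfun x) = e (proj W x).
Proof.
elim/word_ind: x => [|k x y IHx IHy|w]; first by rewrite !linear0.
  by rewrite !linearP IHx IHy.
by rewrite tfunE !projE; case: w => [|a [|b w]] /=; rewrite ?linear0.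
Qed.

Lemma tfun_weight : has_weight 0 e -> has_weight 0 tfun.
Proof.
move=> e0; apply: weight_words => h hh; rewrite tfunE addr0.
have -> : map e (map snd h) = map snd [seq (x.1, e x.2) | x <- h].
  by rewrite -!map_comp.
have -> : hdeg h = hdeg [seq (x.1, e x.2) | x <- h] by rewrite /hdeg big_map.
by apply: homog_word => x /mapP[y yh ->]; apply/weight0/hh.
Qed.

Lemma tfun_cohom : has_weight 0 e -> cohom tfun.
Proof.
move=> e0; apply: (cohom_of_rec (f := e \o proj W)) => [|x].
  exact: tfun_weight.
rewrite {1}[x]reconstruct linearD /= tfun_inc; congr (_ + _).
elim/tpair_ind: (cop W x) => [|k y z IHy IHz|y z]; first by rewrite !linear0.
  by rewrite !linearP IHy IHz.
by rewrite !tmapE !tcatE tfun_rapp.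
Qed.
End Functor.

End CoalgebraMaps.

(** * Coderivations *)

Section Coderivations.
Variables (K : fieldType) (n : nat) (W : gradedSpace K n).
Local Notation T := (tcoalg W).

Definition coder c (E : {linear T -> T}) := has_weight c E /\
  forall x, cop W (E x) = tmap E idfun (cop W x) + tmap (ksign c) E (cop W x).

Lemma coderP c E : coderivation c E <-> coder c E.
Proof.
rewrite /coderivation /coder /cop unlock.
have e x : tmap (idfun \o ksign c) E x = tmap (ksign c) E x by apply: eq_tmap.
by split=> -[cE dE]; split=> // x; rewrite dE tensmap0 tensmap_tmap e.
Qed.

Lemma cohomP (W' : gradedSpace K n) (F : {linear T -> tcoalg W'}) :
  cohomomorphism F <-> cohom F.
Proof.
rewrite /cohomomorphism /cohom /cop !unlock.
by split=> -[F0 dF]; split=> // x; rewrite dF tensmap0.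
Qed.

Lemma cohom_comp (W' W'' : gradedSpace K n) (F : {linear T -> tcoalg W'})
    (F' : {linear tcoalg W' -> tcoalg W''}) : cohom F -> cohom F' -> cohom (F' \o F).
Proof.
move=> [F0 cF] [F0' cF']; split; first exact: weight_comp0.
by move=> x /=; rewrite cF' cF tmap_comp.
Qed.

Lemma cohom_inv (W' : gradedSpace K n) (F : {linear T -> tcoalg W'})
    (F' : {linear tcoalg W' -> T}) :
  cancel F F' -> cancel F' F -> cohom F -> cohom F'.
Proof.
move=> FK FK' [F0 cF]; split.
  apply: gpr_weight => a x; rewrite -{1}[x]FK'.
  by rewrite -[a]addr0 -(weight_gpr F0) !addr0 FK.
move=> x; rewrite -{2}[x]FK' cF tmap_comp.
move: (cop W (F' x)) => z; apply/esym; move: z.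
by apply: (@tens_ext _ _ _ _ _ idfun) => a b; rewrite tmapE /= !FK.
Qed.

(** A coderivation can be transported along F even when F' is only a right
    inverse; this covers restrictions to a stable summand as well as changes of
    coordinates. *)
Lemma coder_conj (W' : gradedSpace K n) c (Q : {linear T -> T})
    (F : {linear T -> tcoalg W'}) (F' : {linear tcoalg W' -> T}) :
  cohom F -> cohom F' -> cancel F' F -> coder c Q ->
  has_weight c (F \o (Q \o F')) /\ forall x, cop W' ((F \o (Q \o F')) x) =
    tmap (F \o (Q \o F')) idfun (cop W' x) + tmap (ksign c) (F \o (Q \o F')) (cop W' x).
Proof.
move=> [F0 cF] [F0' cF'] FK [Qc cQ]; split.
  move=> a x xa; apply/(weight0 F0)/Qc/(weight0 F0') => //.
move=> x /=; rewrite cF cQ cF'; move: (cop W' x).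
apply: (@tens_ext _ _ _ _ (tmap F F \o ((tmap Q idfun \+ tmap (ksign c) Q) \o tmap F' F'))
  (tmap (F \o (Q \o F')) idfun \+ tmap (ksign c) (F \o (Q \o F')))) => a b /=.
rewrite !tmapE linearD /= !tmapE /= FK; congr (_ + tpair _ _).
have := weight_ksign c F0 (F' a); rewrite dotp0 scale1r => <-.
by rewrite FK.
Qed.

(** In the recursion for E that [reconstruct] gives, E is applied either to a
    shorter word, or to the right factor, which it contracts to one letter; the
    length survives only if that factor is a letter, and E kills letters. The
    equation holds for a difference of coderivations, and for the difference of a
    cohomomorphism A and the identity. *)
Lemma coder_lowers (E A : {linear T -> T}) :
  (forall x, cop W (E x) = tmap E A (cop W x) + tmap idfun E (cop W x)) ->
  (forall a, proj W (E (inc W a)) = 0) ->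
  forall m x, short m.+1 x -> short m (E x).
Proof.
move=> cE pE; elim=> [|m IHm] x; elim/short_hind => [|k y z|h hh hm];
  rewrite ?linear0 ?linearP; try exact: short_nil; try exact: short_lin.
  case: h hh hm => [|z [|//]] hh _; rewrite /= ?word_nil ?linear0; first exact: short_nil.
  rewrite -incE [E _]reconstruct pE cE cop_inc !linear0 !addr0 !linear0 !addr0; exact: short_nil.
rewrite [E _]reconstruct; apply: shortD; first exact: short_inc.
rewrite cE !linearD /= !tmap_comp.
elim: (bispan_cop hh) => [|k y z _ IHy _ IHz|h1 h2 hh1 hh2 s1 s2 s12 _].
- by rewrite !linear0 addr0; apply: short_nil.
- by rewrite !linearP addrACA -scalerDr; apply: short_lin.
rewrite !tmapE !tcatE /=; apply: shortD.
  apply/short_rapp/IHm/short_word; rewrite size_map; lia.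
case: h2 hh2 s2 s12 => [//|z [|z' h2]] hh2 _ s12.
  rewrite /= -incE pE (lin0 (rapp_linear _)); exact: short_nil.
by apply: (@shortS _ _ _ (size h1).+1); [move: s12 hm => /=; lia|apply/short_rapp/short_word; rewrite size_map].
Qed.

(** The mixed terms cancel by the Koszul rule, because <c, c> is odd. *)
Lemma anticomm_coder c (Q S : {linear T -> T}) : ksgn K (dotp c c) = - 1 ->
  coder c Q -> coder (- c) S -> has_weight 0 ((Q \o S) \+ (S \o Q)) /\
  forall x, cop W (((Q \o S) \+ (S \o Q)) x) = tmap ((Q \o S) \+ (S \o Q)) idfun (cop W x)
     + tmap idfun ((Q \o S) \+ (S \o Q)) (cop W x).
Proof.
move=> odd [Qc cQ] [Sc cS]; split.
  move=> a x xa /=; apply: homogD.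
    by have := Qc _ _ (Sc _ _ xa); rewrite addr0 subrK.
  by have := Sc _ _ (Qc _ _ xa); rewrite addr0 addrK.
move=> x /=; rewrite linearD /= cQ cS cS cQ; move: (cop W x).
apply: (@tens_ext _ _ _ _
  (((tmap Q idfun \+ tmap (ksign c) Q) \o (tmap S idfun \+ tmap (ksign (- c)) S)) \+
   ((tmap S idfun \+ tmap (ksign (- c)) S) \o (tmap Q idfun \+ tmap (ksign c) Q)))
  (tmap ((Q \o S) \+ (S \o Q)) idfun \+ tmap idfun ((Q \o S) \+ (S \o Q)))) => a b /=.
rewrite !tmapE !linearD /= !tmapE /= !ksignD subrr addNr !ksign0.
rewrite (weight_ksign c Sc) (weight_ksign (- c) Qc) dotpNr dotpNl !ksgnN odd.
rewrite !scaleN1r !ksignN -!scaleN1r !tpairZl !scaleN1r tpairDl tpairDr.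
set s1 := tpair (Q (S a)) b; set s2 := tpair (S (Q a)) b.
set t1 := tpair a (Q (S b)); set t2 := tpair a (S (Q b)).
set u := tpair _ _; set v := tpair _ _.
(* The signs of the mixed terms u and v are opposite, as <c, c> is odd. *)
rewrite [LHS](AC ((2*2)*(2*2)) (((2*7)*(6*3))*((1*5)*(4*8)))).
by rewrite /= !subrr addr0 add0r.
Qed.

Definition derivation (E : {linear T -> T}) :=
  forall x, cop W (E x) = tmap E idfun (cop W x) + tmap idfun E (cop W x).

Lemma coder0_derivation E : coder 0 E -> derivation E.
Proof.
case=> _ cE x; rewrite cE; congr (_ + _); apply: eq_tmap => // a; exact: ksign0.
Qed.

Lemma derivationB E E' : derivation E -> derivation E' -> derivation (E \- E').
Proof.
move=> dE dE' x; rewrite [LHS]linearB /= dE dE'; move: (cop W x).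
apply: (@tens_ext _ _ _ _ ((tmap E idfun \+ tmap idfun E) \-
    (tmap E' idfun \+ tmap idfun E'))
  (tmap (E \- E') idfun \+ tmap idfun (E \- E'))) => a b /=.
by rewrite !tmapE /= opprD addrACA tpairBl tpairBr.
Qed.

Section Extension.
Variables (c : 'rV[int]_n) (s : {linear W -> W}).
Hypothesis sc : has_weight c s.

(** The extension of s to words as a derivation for concatenation. The argument
    is the reversed word, so that the recursion removes the last letter, as the
    recursion for the coproduct does. Words with one letter are treated apart,
    because the empty word is zero and not a unit. *)
Fixpoint derive_rev (r : seq W) : T :=
  if r is a :: r' then rapp a (derive_rev r') +
    (if r' is [::] then inc W (s a) else rapp (s a) (ksign c (word (rev r') : T)))
  else 0.

Lemma derive_multilinear : multilinear (fun w => derive_rev (rev w)).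
Proof.
move=> k a b u v /=; rewrite !rev_cat !rev_cons -!cats1 -!catA /=.
elim: (rev v) (rev u) => [|z {}v IHv] {}u /=.
  case: u => [|y u]; first by rewrite !linear0 !add0r !linearP.
  by rewrite linearP !rapp_linear scalerDr addrACA.
rewrite IHv linearP scalerDr [RHS]addrACA; congr (_ + _).
have e x : (if v ++ x :: u is [::] then inc W (s z)
   else rapp (s z) (ksign c (word (rev (v ++ x :: u)) : T))) =
   rapp (s z) (ksign c (word (rev u ++ x :: rev v) : T)).
  by rewrite rev_cat rev_cons cat_rcons; case: v {IHv}.
by rewrite !e word_multilinear !linearP.
Qed.

Definition derive : {linear T -> T} := locked_with (lock_key 22)
  (@tlift K W T (fun w => derive_rev (rev w)) (erefl _) derive_multilinear
    : {linear tmod W -> T}).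

Lemma derive_inc a : derive (inc W a) = inc W (s a).
Proof. by rewrite incE /derive unlock tliftE /= linear0 add0r. Qed.

Lemma derive_rapp a y : derive (rapp a y) = rapp a (derive y) + rapp (s a) (ksign c y).
Proof.
elim/word_ind: y => [|k x y IHx IHy|w]; first by rewrite !linear0 addr0.
  by rewrite !linearP IHx IHy scalerDr addrACA.
case: (lastP w) => [|w' b]; first by rewrite word_nil !linear0 addr0.
have w0 : rcons w' b != [::] by case: w'.
rewrite rapp_word // /derive unlock !tliftE [in LHS]rev_rcons /= [in LHS]rev_rcons.
by rewrite -rev_rcons revK.
Qed.

Lemma derive_weight : has_weight c derive.
Proof.
apply: weight_words; elim/last_ind => [|h z IHh] hh.
  by rewrite /= word_nil linear0; apply: homog0.
have [{}hh hz] := (hhomog_rcons h z).1 hh.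
rewrite hdeg_rcons; case: (posnP (size h)) => [/size0nil ->|h0].
  rewrite /= -incE derive_inc /hdeg big_nil add0r.
  exact: (weight0 (@inc_weight _ _ W)) (sc hz).
rewrite map_rcons -rapp_word -?size_eq0 ?size_map -?lt0n // derive_rapp; apply: homogD.
  by rewrite addrAC; apply: rapp_weight; last exact: IHh.
rewrite -addrA; apply: rapp_weight; first exact: sc.
by apply/(weight0 (@ksign_weight _ _ _ _))/homog_word.
Qed.

Lemma ksign_cop x : cop W (ksign c x) = tmap (ksign c) (ksign c) (cop W x).
Proof.
elim/hword_ind: x => [|k x y IHx IHy|h hh]; first by rewrite !linear0.
  by rewrite !linearP IHx IHy.
rewrite (ksignE _ (homog_word hh)) linearZ /=.
elim: (bispan_cop hh) => [|k y z _ IHy _ IHz|h1 h2 hh1 hh2 _ _ _ <-].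
- by rewrite !linear0.
- by rewrite !linearP -IHy -IHz.
rewrite tmapE /= (ksignE _ (homog_word hh1)) (ksignE _ (homog_word hh2)) tpairZl tpairZr.
by rewrite scalerA dotpDr expfzDr // oppr_eq0 oner_eq0.
Qed.

Lemma swap_coder (E : {linear T -> T}) z : has_weight c E ->
  swap W (tmap E idfun z + tmap (ksign c) E z) =
  tmap E idfun (swap W z) + tmap (ksign c) E (swap W z).
Proof.
move=> Ec; move: z; apply: (@tens_hext _ _ _ _ _
  (swap W \o (tmap E idfun \+ tmap (ksign c) E))
  ((tmap E idfun \+ tmap (ksign c) E) \o swap W)) => d e a b ad be /=.
rewrite !tmapE (swapEh ad be) !linearD /= (ksignE _ ad) tpairZl !linearZ /= !tmapE /=.
rewrite (swapEh (Ec _ _ ad) be) (swapEh ad (Ec _ _ be)) (ksignE _ be) tpairZl.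
rewrite dotpDl dotpDr -/(ksgn K _) -/(ksgn K _) !ksgnD addrC !scalerA; congr (_ *: _ + _ *: _).
by rewrite (dotpC d c) mulrC -mulrA ksgnM mulr1.
Qed.

Lemma ksign_swap z :
  swap W (tmap (ksign c) (ksign c) z) = tmap (ksign c) (ksign c) (swap W z).
Proof. by apply: swap_weight0; apply: ksign_weight. Qed.

Lemma derive_coder : coder c derive.
Proof.
split; first exact: derive_weight.
elim/concat_ind => [|k x y IHx IHy|a|a w _].
- by rewrite !linear0 addr0.
- by rewrite !linearP IHx IHy scalerDr addrACA.
- by rewrite derive_inc !cop_inc !linear0 addr0.
set y : T := word w => IHy.
have bS : bicop W (derive y) = tmap derive idfun (bicop W y)
   + tmap (ksign c) derive (bicop W y).
  rewrite !bicopE IHy swap_coder; last exact: derive_weight.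
  by rewrite !linearD /= addrACA.
have bk : bicop W (ksign c y) = tmap (ksign c) (ksign c) (bicop W y).
  by rewrite !bicopE ksign_cop ksign_swap linearD.
rewrite derive_rapp linearD /= !cop_rapp bS bk !linearD /= !tmapE derive_inc /=.
move: (bicop W y) => z; rewrite -!addrA; congr (_ + _); rewrite [RHS]addrCA.
rewrite [LHS](AC (1*(1*2)) (3*(1*(2*4)))) /=; congr (_ + _).
move: z; apply: (@tens_ext _ _ _ _
 ((tmap idfun (rapp a) \o tmap derive idfun) \+
  ((tmap idfun (rapp a) \o tmap (ksign c) derive) \+
  (tmap idfun (rapp (s a)) \o tmap (ksign c) (ksign c))))
 ((tmap derive idfun \o tmap idfun (rapp a)) \+
  (tmap (ksign c) derive \o tmap idfun (rapp a)))) => u v /=.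
by rewrite !tmapE /= derive_rapp tpairDr.
Qed.
End Extension.

End Coderivations.

(** * Complements, generalized inverses and a contracting homotopy *)

Section Complement.
Variable K : fieldType.

Definition lin_closed (V : lmodType K) (X : V -> Prop) :=
  forall k x y, X x -> X y -> X (k *: x + y).

(** A maximal subspace meeting A trivially is a complement of A. The empty set is
    admitted so that the union of an empty chain is. *)
Lemma complement (V : lmodType K) (A : V -> Prop) : A 0 -> lin_closed A ->
  exists X : V -> Prop, [/\ X 0, lin_closed X, forall x, A x -> X x -> x = 0 &
    forall v, exists a x, [/\ A a, X x & v = a + x]].
Proof.
move=> A0 Al; pose P (X : classical_sets.set V) := lin_closed X /\ forall x, X x -> A x -> x = 0.
have [|X [[Xl XA] Xmax]] := @classical_sets.Zorn_bigcup V P.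
  move=> F FP Ftot; split=> [k x y [X FX Xx] [Y FY Yy]|x [X FX Xx]]; last exact: (FP X FX).2.
  have [XY|YX] := Ftot _ _ FX FY.
    by exists Y => //; apply: (FP _ FY).1 => //; apply: XY.
  by exists X => //; apply: (FP _ FX).1 => //; apply: YX.
(* A maximal X may be empty as far as the closure condition goes; X0 is its span. *)
pose X0 x := X x \/ x = 0.
have X0l : lin_closed X0.
  move=> k x y [Xx|->] [Xy|->]; last by right; rewrite scaler0 addr0.
  - by left; apply: Xl.
  - rewrite addr0; have Xz : X 0 by have := Xl (-1) _ _ Xx Xx; rewrite scaleN1r addNr.
    by left; rewrite -[_ *: _]addr0; apply: Xl.
  - by rewrite scaler0 add0r; left.
exists X0; split=> [|//|x Ax [/XA->//|//]|v]; first by right.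
apply: contrapT => vN; pose Y z := exists k x, X0 x /\ z = k *: v + x.
apply: (Xmax Y); last first.
  split=> [k _ _ [l [x [Xx ->]]] [m [y [Xy ->]]]|_ [k [x [Xx ->]]] Akvx].
    exists (k * l + m), (k *: x + y); split; first exact: X0l.
    by rewrite scalerDl scalerDr scalerA addrACA.
  have [k0|k0] := eqVneq k 0.
    by move: Akvx; rewrite k0 scale0r add0r; case: Xx => [/XA|->].
  exfalso; apply: vN; exists (k^-1 *: (k *: v + x)), (- k^-1 *: x); split.
  - by rewrite -[_ *: _]addr0; apply: Al.
  - by rewrite -[_ *: _]addr0; apply: X0l => //; right.
  by rewrite scalerDr scalerA mulVf // scale1r scaleNr addrK.
split=> [x Xx|YX]; first by exists 0, x; rewrite scale0r add0r; split=> //; left.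
apply: vN; exists 0, v; split; rewrite ?add0r //; left; apply: YX.
by exists 1, 0; rewrite scale1r addr0; split=> //; right.
Qed.

Lemma linear_of_fun (V U : lmodType K) (f : V -> U) : linear f ->
  exists g : {linear V -> U}, g =1 f.
Proof.
by move=> fl; pose g : {linear V -> U} := HB.pack f (GRing.isLinear.Build K V U _ f fl); exists g.
Qed.

(** Projections and inverses are first known as relations. Subtracting two values
    at the same vector gives a value at 0, so such a relation is a function. *)
Lemma linear_graph (V U : lmodType K) (R : V -> U -> Prop) :
  (forall v, exists u, R v u) -> (forall u, R 0 u -> u = 0) ->
  (forall k v u v' u', R v u -> R v' u' -> R (k *: v + v') (k *: u + u')) ->
  exists g : {linear V -> U}, forall v, R v (g v).
Proof.
move=> Rex R0 Rl; have Rf v u u' : R v u -> R v u' -> u = u'.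
  move=> vu vu'; apply/eqP; rewrite -subr_eq0; apply/eqP/R0.
  by have := Rl (-1) _ _ _ _ vu' vu; rewrite !scaleN1r addNr addrC.
pose f v := projT1 (cid (Rex v)); have fP v : R v (f v) by rewrite /f; case: cid.
have [|g gf] := @linear_of_fun _ _ f; last by exists g => v; rewrite gf.
by move=> k x y; apply: Rf (fP _) _; apply: Rl.
Qed.

Lemma projection_onto (V : lmodType K) (A : V -> Prop) : A 0 -> lin_closed A ->
  exists e : {linear V -> V}, (forall v, A (e v)) /\ (forall a, A a -> e a = a).
Proof.
move=> A0 Al; have [X [X0 Xl AX AXV]] := complement A0 Al.
have An x y : A x -> A y -> A (x - y) by move=> Ax Ay; rewrite addrC -scaleN1r; apply: Al.
have Xn x y : X x -> X y -> X (x - y) by move=> Ax Ay; rewrite addrC -scaleN1r; apply: Xl.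
have [v|a [Aa]|k v u v' u' [Au Xu] [Au' Xu']|e eP] :=
    @linear_graph V V (fun v a => A a /\ X (v - a)).
- by have [a [x [Aa Xx ->]]] := AXV v; exists a; rewrite addrAC subrr add0r.
- rewrite sub0r => /(Xl (-1) _ _)/(_ X0); rewrite scaleN1r opprK addr0; exact: AX.
- split; first exact: Al.
  by rewrite opprD addrACA -scalerBr; apply: Xl.
exists e; split=> [v|a Aa]; first by case: (eP v).
have [Aea Xea] := eP a; apply/esym/eqP; rewrite -subr_eq0; apply/eqP/AX => //.
exact: An.
Qed.

Lemma generalized_inverse (U V : lmodType K) (f : {linear U -> V}) :
  exists g : {linear V -> U}, forall x, f (g (f x)) = f x.
Proof.
have [|k x y [u <-] [v <-]|e [eim eid]] :=
    @projection_onto V (fun v => exists u, f u = v).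
- by exists 0; rewrite linear0.
- by exists (k *: u + v); rewrite linearP.
have [|k x y x0 y0|z [zker zid]] := @projection_onto U (fun u => f u = 0).
- by rewrite linear0.
- by rewrite linearP x0 y0 scaler0 addr0.
have [v|u [zu]|k v u v' u' [zu fu] [zu' fu']|g gP] :=
    @linear_graph V U (fun v u => z u = 0 /\ f u = e v).
- have [u fu] := eim v; exists (u - z u); rewrite !linearB /= (zid (z u)) ?subrr //.
  by rewrite zker subr0.
- by rewrite linear0 => /zid zu'; rewrite -zu' zu.
- by rewrite !linearP zu zu' fu fu' scaler0 addr0.
by exists g => x; rewrite (gP _).2 eid //; exists x.
Qed.

End Complement.

Section Homotopy.
Variables (K : fieldType) (n : nat) (W : gradedSpace K n) (c : 'rV[int]_n).
Variable d : {linear W -> W}.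
Hypotheses (dc : has_weight c d) (dd : forall x, d (d x) = 0).

Lemma graded_generalized_inverse :
  exists g : {linear W -> W}, has_weight (- c) g /\ forall x, d (g (d x)) = d x.
Proof.
have [g gP] := generalized_inverse d.
have [|g' g'E] := @linear_of_fun K W W
    (fun v => \sum_(a <- gsupp v) gpr (a - c) (g (gpr a v))).
  move=> k x y; apply: (@gsupp_lin K n W W (fun a z => gpr (a - c) (g z))) => a l u v.
  by rewrite !linearP.
have g'h a v : homog a v -> g' v = gpr (a - c) (g v).
  move=> va; rewrite g'E (@big_homog K n W W (fun a z => gpr (a - c) (g z)) a) // => b.
  by rewrite !linear0.
exists g'; split=> [a v va|x]; first by rewrite (g'h _ _ va) /homog gpr_id.
elim/gradedSpace_ind: x => [|x y IHx IHy|a x xa]; first by rewrite !linear0.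
  by rewrite !linearD /= IHx IHy.
by rewrite (g'h _ _ (dc xa)) addrK (weight_gpr dc) gP (dc xa).
Qed.

(** The composite g d g satisfies the first two equations; the factor 1 - g d
    makes it vanish on the image of g d, and s s = 0 follows. *)
Lemma homotopy : exists s : {linear W -> W}, [/\ has_weight (- c) s,
  forall x, d (s (d x)) = d x, forall x, s (d (s x)) = s x & forall x, s (s x) = 0].
Proof.
have [g [gc dgd]] := graded_generalized_inverse.
pose s : {linear W -> W} := g \o d \o g \o (idfun \- (g \o d)).
have sE x : s x = g (d (g (x - g (d x)))) by [].
have gdgB x y : g (d (g (x - y))) = g (d (g x)) - g (d (g y)) by rewrite !linearB.
exists s; split=> [a x xa|x|x|x]; rewrite ?sE.
- have gx y b : homog b y -> homog b (d (g y)).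
    by move=> yb; have := dc (gc _ _ yb); rewrite subrK.
  have gdx y b : homog b y -> homog b (g (d y)).
    by move=> yb; have := gc _ _ (dc yb); rewrite addrK.
  by apply/gdx/gc; rewrite addrC -scaleN1r; apply: homog_lin => //; apply: gdx.
- by rewrite dd linear0 subr0 !dgd.
- by rewrite dd linear0 subr0 !dgd.
by rewrite gdgB !dgd subrr.
Qed.
End Homotopy.

(** * Invertibility by triangularity *)

Section LocallyAlgebraic.
Variables (K : fieldType) (V : lmodType K) (A : {linear V -> V}).

(** Polynomials in A, given by their roots. *)
Definition annih (r : seq K) (x : V) : V := foldr (fun k y => A y - k *: y) x r.

Lemma annih_linear r : linear (annih r).
Proof.
move=> k x y; elim: r => //= m r ->; rewrite [A _]linearP scalerDr opprD addrACA.
by rewrite [k *: (_ - _)]scalerBr !scalerA (mulrC m).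
Qed.

Lemma annihA r x : annih r (A x) = A (annih r x).
Proof. by elim: r => //= m r ->; rewrite [RHS](linearB A) (linearZ_LR A). Qed.

(** The factors commute, so vectors annihilated by two products are annihilated
    by both of them composed. *)
Lemma annihC r r' x : annih r (annih r' x) = annih r' (annih r x).
Proof.
elim: r' => //= m r' <-; set z := annih r' x.
have -> : A z - m *: z = - m *: z + A z by rewrite scaleNr addrC.
by rewrite annih_linear annihA scaleNr addrC.
Qed.

Definition nz_annihilated x := exists r : seq K, all (predC1 0) r /\ annih r x = 0.

(** If P(A) x = 0 for a polynomial P with P(0) nonzero, then x is recovered from A x
    by dividing P(A) - P(0) by A. *)
Lemma nz_annihilated_bij : (forall x, nz_annihilated x) ->
  exists B : {linear V -> V}, cancel A B /\ cancel B A.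
Proof.
move=> Aalg; have A_inj x : A x = 0 -> x = 0.
  move=> Ax; have [r [r0 rx]] := Aalg x.
  have : exists2 k : K, k != 0 & annih r x = k *: x.
    (* k is P(0), for P the polynomial with roots r. *)
    elim: r r0 {rx} => [|m r IHr] /=; first by exists 1; rewrite ?oner_eq0 ?scale1r.
    case/andP=> m0 /IHr[k k0 ->]; exists (- m * k); first by rewrite mulf_neq0 ?oppr_eq0.
    by rewrite linearZ /= Ax scaler0 sub0r scalerA mulNr scaleNr.
  case=> k k0 e; move: rx; rewrite e => /(congr1 ( *:%R k^-1)).
  by rewrite scalerA mulVf // scale1r scaler0.
have A_surj x : exists y, A y = x.
  have [r [r0 rx]] := Aalg x.
  have : exists k y, k != 0 /\ annih r x = k *: x + A y.
    elim: r r0 {rx} => [|m r IHr] /=.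
      by exists 1, 0; rewrite oner_eq0 scale1r linear0 addr0.
    case/andP=> m0 /IHr[k [y [k0 ->]]].
    exists (- m * k), (k *: x + A y - m *: y); split; first by rewrite mulf_neq0 ?oppr_eq0.
    rewrite (linearB A) (linearZ_LR A) [m *: (_ + _)]scalerDr opprD mulNr scaleNr scalerA.
    by rewrite addrCA.
  case=> k [y [k0 e]]; exists (- k^-1 *: y); move: rx; rewrite e addrC.
  move/eqP; rewrite addr_eq0 => /eqP Ay; rewrite (linearZ_LR A) Ay.
  by rewrite scalerN scaleNr opprK scalerA mulVf // scale1r.
have [//|u /A_inj->//|k v u v' u' <- <-|B AB] := @linear_graph K V V (fun v u => A u = v).
- by rewrite linearP.
exists B; split=> // x; apply/eqP; rewrite -subr_eq0; apply/eqP/A_inj.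
by rewrite linearB /= AB subrr.
Qed.

End LocallyAlgebraic.

Section Filtered.
Variables (K : fieldType) (n : nat) (W : gradedSpace K n).
Local Notation T := (tcoalg W).

Lemma word_zero (w : seq W) : 0 \in w -> word w = 0.
Proof.
case/splitPr=> u v; have := word_multilinear (-1) 0 0 u v.
by rewrite scaler0 addr0 scaleN1r addNr.
Qed.

Definition pure (p : W -> W) (w : seq W) := all (fun a => (p a == a) || (p a == 0)) w.

(** Splitting each letter a as p a + (a - p a), one sees that words in eigenvectors
    of an idempotent p span. *)
Lemma pure_ind (p : {linear W -> W}) (pp : forall a, p (p a) = p a) m (P : T -> Prop) :
  P 0 -> (forall k x y, P x -> P y -> P (k *: x + y)) ->
  (forall w, pure p w -> (size w <= m)%N -> P (word w)) -> forall x, short m x -> P x.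
Proof.
move=> P0 Pl Pw x; elim=> // [k y z _ Py _ Pz|w]; first exact: Pl.
have : pure p [::] by []; rewrite -[in size w](cat0s w) -[in word w](cat0s w).
move: [::]; elim: w => [|a w IHw] u pu uw; first by apply: Pw; rewrite ?cats0 // -[u]cats0.
rewrite size_cat /= in uw; have -> : a = 1 *: p a + (a - p a) by rewrite scale1r addrC subrK.
rewrite word_multilinear -!cat_rcons; apply: Pl; apply: IHw;
  rewrite ?size_cat ?size_rcons /= /pure ?all_rcons ?pp ?eqxx //=.
- by rewrite addSnnS.
- by rewrite linearB /= pp subrr eqxx orbT.
by rewrite addSnnS.
Qed.

(** By induction on the length, each vector is annihilated by a product of maps
    A - k with k nonzero. *)
Lemma triangular_bij (A : {linear T -> T}) (p : {linear W -> W}) :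
  (forall a, p (p a) = p a) ->
  (forall w m, pure p w -> size w = m.+1 ->
     exists2 k : K, k != 0 & short m (A (word w) - k *: word w)) ->
  exists B : {linear T -> T}, cancel A B /\ cancel B A.
Proof.
move=> pp Aw; apply: nz_annihilated_bij => x; have [m] := short_ex x.
elim: m x => [|m IHm] x; first by move/short0 => ->; exists [::].
elim/(pure_ind pp) => [|k y z [r [r0 ry]] [t [t0 tz]]|w pw].
- by exists [::].
- exists (r ++ t); split; first by rewrite all_cat r0.
  rewrite /annih foldr_cat -!/(annih A _ _) annih_linear -/(annih A r _).
  rewrite !annih_linear tz annihC ry !(lin0 (annih_linear A _)).
  by rewrite scaler0 addr0.
rewrite leq_eqVlt => /predU1P[wm|]; last by rewrite ltnS => wm; apply/IHm/short_word.
have [k k0 /IHm[r [r0 rw]]] := Aw w m pw wm.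
exists (rcons r k); split; first by rewrite all_rcons /= k0.
by rewrite /annih foldr_rcons.
Qed.

Lemma unipotent_bij (F : {linear T -> T}) : cohom F ->
  (forall a, proj W (F (inc W a)) = a) ->
  exists B : {linear T -> T}, cancel F B /\ cancel B F.
Proof.
move=> [F0 cF] pF; apply: (@triangular_bij F \0) => // w m _ wm.
exists 1; first exact: oner_neq0.
rewrite scale1r -[_ - _]/((F \- idfun) (word w)).
apply: (@coder_lowers _ _ _ (F \- idfun) F) => [x|a|] /=.
- rewrite linearB /= cF; move: (cop W x).
  apply: (@tens_ext _ _ _ _ (tmap F F \- idfun)
    (tmap (F \- idfun) F \+ tmap idfun (F \- idfun))) => a b /=.
  by rewrite !tmapE /= tpairDl tpairDr -!scaleN1r tpairZl tpairZr !scaleN1r addrA subrK.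
- by rewrite linearB /= pF proj_inc subrr.
by apply: short_word; rewrite wm.
Qed.

Lemma derive_pure (p : {linear W -> W}) w : pure p w ->
  derive 0 p (word w) = (count (fun a => p a == a) w)%:R *: word w.
Proof.
elim/last_ind: w => [|w a IHw]; first by rewrite word_nil linear0 scaler0.
rewrite /pure all_rcons => /andP[pa pw].
have [->|w0] := eqVneq w [::].
  rewrite /= -incE derive_inc; have [->|pa'] := eqVneq (p a) a; first by rewrite scale1r.
  by move: pa; rewrite (negPf pa') => /eqP->; rewrite scale0r linear0.
rewrite -rapp_word // derive_rapp ksign0 IHw // linearZ /= -cats1 count_cat /= addn0.
rewrite natrD scalerDl; congr (_ + _).
have [->|pa'] := eqVneq (p a) a; first by rewrite scale1r.
by move: pa; rewrite (negPf pa') => /eqP->; rewrite scale0r (lin0 (rapp_linear _)).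
Qed.

Lemma tfun_compl_pure (p : {linear W -> W}) w : pure p w ->
  tfun (idfun \- p) (word w) = (count (fun a => p a == a) w == 0)%:R *: word w.
Proof.
move=> pw; rewrite tfunE; case: eqP => [c0|/eqP].
  rewrite scale1r; congr word; apply: map_id_in => a aw /=.
  move/allP: pw => /(_ a aw); have [pa _|_ /eqP->] := eqVneq (p a) a; last by rewrite subr0.
  by move: c0; rewrite -size_filter => /size0nil f0;
    have : a \in [::]; rewrite // -f0 mem_filter aw pa eqxx.
rewrite -lt0n -has_count => /hasP[a aw /eqP pa]; rewrite scale0r; apply: word_zero.
by apply/mapP; exists a; rewrite //= pa subrr.
Qed.

End Filtered.

(** * Straightening a codifferential and splitting off the acyclic part *)

Section Restrict.
Variables (K : fieldType) (n : nat) (W : gradedSpace K n) (c : 'rV[int]_n).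
Local Notation T := (tcoalg W).

Lemma tfun_comp (W' W'' : gradedSpace K n) (e : {linear W -> W'}) (e' : {linear W' -> W''}) x :
  tfun e' (tfun e x) = tfun (e' \o e) x.
Proof.
elim/word_ind: x => [|k x y IHx IHy|w]; first by rewrite !linear0.
  by rewrite !linearP IHx IHy.
by rewrite !tfunE -map_comp.
Qed.

Lemma tfun_id (e : {linear W -> W}) x : (forall a, e a = a) -> tfun e x = x.
Proof.
move=> ea; elim/word_ind: x => [|k x y IHx IHy|w]; first by rewrite !linear0.
  by rewrite !linearP IHx IHy.
by rewrite tfunE map_id_in.
Qed.

Lemma eq_tfun (W' : gradedSpace K n) (e e' : {linear W -> W'}) x :
  e =1 e' -> tfun e x = tfun e' x.
Proof.
move=> ea; elim/word_ind: x => [|k x y IHx IHy|w]; first by rewrite !linear0.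
  by rewrite !linearP IHx IHy.
by rewrite !tfunE (eq_map ea).
Qed.

Lemma weight0_ksign (W' : gradedSpace K n) d (f : {linear W -> W'}) : has_weight 0 f ->
  forall x, ksign d (f x) = f (ksign d x).
Proof. by move=> f0 x; rewrite (weight_ksign d f0) dotp0 scale1r. Qed.

(** Q T(e) and T(e) Q T(e) are both coderivations along T(e), so they agree when
    their corestrictions do. *)
Lemma coder_stable (Q : {linear T -> T}) (e : {linear W -> W}) :
  coder c Q -> has_weight 0 e -> (forall a, e (e a) = e a) ->
  (forall x, proj W (Q (tfun e x)) = e (proj W (Q (tfun e x)))) ->
  forall x, Q (tfun e x) = tfun e (Q (tfun e x)).
Proof.
move=> [Qc cQ] e0 ee tQ x; have [E0 cE] := tfun_cohom e0.
have EE y : tfun e (tfun e y) = tfun e y by rewrite tfun_comp; apply: eq_tfun.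
apply/eqP; rewrite -subr_eq0; apply/eqP.
apply: (@coder_eq0 _ _ _ _ ((Q \o tfun e) \- (tfun e \o Q \o tfun e)) (tfun e)
  (ksign c \o tfun e)) => {}x /=; first by rewrite linearB /= proj_tfun -tQ subrr.
rewrite linearB /= cE !cQ !cE; move: (cop W x).
apply: (@tens_ext _ _ _ _
  (((tmap Q idfun \+ tmap (ksign c) Q) \o tmap (tfun e) (tfun e)) \-
   (tmap (tfun e) (tfun e) \o ((tmap Q idfun \+ tmap (ksign c) Q) \o tmap (tfun e) (tfun e))))
  (tmap ((Q \o tfun e) \- (tfun e \o Q \o tfun e)) (tfun e) \+
   tmap (ksign c \o tfun e) ((Q \o tfun e) \- (tfun e \o Q \o tfun e)))) => a b /=.
rewrite !tmapE linearD /= !tmapE /= EE.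
have -> : tfun e (ksign c (tfun e a)) = ksign c (tfun e a).
  by have := weight_ksign c E0 (tfun e a); rewrite dotp0 scale1r EE.
by rewrite opprD addrACA tpairDl tpairDr -!scaleN1r tpairZl tpairZr.
Qed.

End Restrict.

Section KernelProjector.
Variables (K : fieldType) (n : nat) (W : gradedSpace K n).
Local Notation T := (tcoalg W).
Variables L pi0 A' : {linear T -> T}.
Hypotheses (L0 : has_weight 0 L) (dL : derivation L).
Hypotheses (pi0_cohom : cohom pi0) (pi0K : forall x, pi0 (pi0 x) = pi0 x).
Hypothesis Lpi0 : forall x, L (pi0 x) = 0.
Hypotheses (AK : forall x, A' (L x + pi0 x) = x) (A'K : forall x, L (A' x) + pi0 (A' x) = x).

(** On T(W), which is the sum of the images of pi0 and of L, this is the projection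
    onto the former along the latter: L + pi0 is invertible and fixes the
    image of pi0. *)
Definition kerproj : {linear T -> T} := pi0 \o A'.

Lemma kerproj_pi0 x : kerproj (pi0 x) = pi0 x.
Proof. by rewrite /kerproj /=; have := AK (pi0 x); rewrite Lpi0 add0r pi0K => ->. Qed.

Lemma kerproj_L x : kerproj (L x) = 0.
Proof.
have : kerproj (L x + pi0 x) = pi0 x by rewrite /kerproj /= AK.
by rewrite (linearD kerproj) kerproj_pi0 => /(canRL (addrK _)); rewrite subrr.
Qed.

Lemma kerproj_ind (R : T -> Prop) :
  (forall x y, R x -> R y -> R (x + y)) -> (forall x, R (L x)) -> (forall x, R (pi0 x)) ->
  forall x, R x.
Proof. by move=> RD RL R0 x; rewrite -[x]A'K; apply: RD. Qed.

Lemma kerproj_comm (Q : {linear T -> T}) : (forall x, L (Q x) = Q (L x)) ->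
  (forall x, Q (pi0 x) = pi0 (Q (pi0 x))) -> forall x, kerproj (Q x) = Q (kerproj x).
Proof.
move=> LQ Qpi0; elim/kerproj_ind => [x y IHx IHy|x|x].
- by rewrite !(linearD Q) !(linearD kerproj) IHx IHy (linearD Q).
- by rewrite -LQ !kerproj_L linear0.
by rewrite kerproj_pi0 Qpi0 kerproj_pi0.
Qed.

Lemma kerproj_weight : has_weight 0 kerproj.
Proof.
apply: weight_comp0; last by case: pi0_cohom.
apply: gpr_weight => a x; rewrite addr0 -{1}[x]A'K.
have := weight_gpr L0 a (A' x); have := weight_gpr pi0_cohom.1 a (A' x).
by rewrite !addr0 gprD => <- <-; rewrite AK.
Qed.

(** On the image of pi0 the projection is the identity. On the image of L both
    sides vanish, as L is a derivation for the coproduct and its image is killed. *)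
Lemma kerproj_cohom : cohom kerproj.
Proof.
split; first exact: kerproj_weight.
elim/kerproj_ind => [x y IHx IHy|x|x].
- by rewrite (linearD kerproj) !(linearD (cop W)) IHx IHy linearD.
- rewrite kerproj_L dL linear0 linearD /= !tmap_comp.
  by rewrite tmap0l ?tmap0r ?addr0 // => y; apply: kerproj_L.
rewrite kerproj_pi0 !(pi0_cohom.2) tmap_comp.
by apply: eq_tmap => y; rewrite [RHS]kerproj_pi0.
Qed.
End KernelProjector.

Section Splitting.
Variables (K : fieldType) (charK : [pchar K]%R =i pred0).
Variables (n : nat) (W : gradedSpace K n) (c : 'rV[int]_n).
Local Notation T := (tcoalg W).
Local Notation t := (proj W).
Hypothesis odd_c : ksgn K (dotp c c) = - 1.

Variables (Q : {linear T -> T}) (d s : {linear W -> W}).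
Hypotheses (cQ : coder c Q) (QQ : forall x, Q (Q x) = 0).
Hypothesis Q_inc : forall a, Q (inc W a) = inc W (d a).
Hypotheses (sc : has_weight (- c) s) (dsd : forall a, d (s (d a)) = d a)
  (sds : forall a, s (d (s a)) = s a) (ss : forall a, s (s a) = 0).

Lemma lin_part_sq a : d (d a) = 0.
Proof.
have := QQ (inc W a); rewrite !Q_inc => /(congr1 t).
by rewrite proj_inc linear0.
Qed.

Lemma lin_part_weight : has_weight c d.
Proof.
move=> a x xa; have := cQ.1 _ _ (weight0 (@inc_weight _ _ W) xa).
by rewrite Q_inc => /(weight0 (@proj_weight _ _ W)); rewrite proj_inc.
Qed.

(** The projections p and 1 - p: onto the acyclic part of W, and onto a
    complement of im d in ker d. *)
Definition acyc : {linear W -> W} := (d \o s) \+ (s \o d).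
Definition harm : {linear W -> W} := idfun \- acyc.

Lemma acycE a : acyc a = d (s a) + s (d a). Proof. by []. Qed.
Lemma harmE a : harm a = a - acyc a. Proof. by []. Qed.

Lemma d_acyc a : d (acyc a) = d a.
Proof. by rewrite acycE linearD /= lin_part_sq dsd add0r. Qed.
Lemma acyc_d a : acyc (d a) = d a.
Proof. by rewrite acycE lin_part_sq linear0 addr0 dsd. Qed.
Lemma s_acyc a : s (acyc a) = s a.
Proof. by rewrite acycE linearD /= sds ss addr0. Qed.
Lemma acyc_s a : acyc (s a) = s a.
Proof. by rewrite acycE ss linear0 add0r sds. Qed.
Lemma acyc_idem a : acyc (acyc a) = acyc a.
Proof. by rewrite {1}acycE s_acyc d_acyc. Qed.
Lemma harm_idem a : harm (harm a) = harm a.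
Proof. by rewrite !harmE (linearB acyc) acyc_idem subrr subr0. Qed.
Lemma acyc_harm a : acyc (harm a) = 0.
Proof. by rewrite harmE (linearB acyc) acyc_idem subrr. Qed.
Lemma harm_acyc a : harm (acyc a) = 0.
Proof. by rewrite harmE acyc_idem subrr. Qed.
Lemma d_harm a : d (harm a) = 0.
Proof. by rewrite harmE (linearB d) d_acyc subrr. Qed.
Lemma s_harm a : s (harm a) = 0.
Proof. by rewrite harmE (linearB s) s_acyc subrr. Qed.

Lemma acyc_weight : has_weight 0 acyc.
Proof.
move=> a x xa; rewrite addr0 acycE; apply: homogD.
  by have := lin_part_weight (sc xa); rewrite subrK.
by have := sc (lin_part_weight xa); rewrite addrK.
Qed.

Lemma harm_weight : has_weight 0 harm.
Proof.
move=> a x xa; rewrite addr0 harmE; apply: homogB => //.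
exact: weight0 acyc_weight _ _ xa.
Qed.

Section Straightening.

(** This is t - p t + (d s t + s t Q): the letters, with the component in the image
    of p replaced by a chain map with the same linear part. *)
Definition straighten_corestr : {linear T -> W} := t \+ (s \o ((t \o Q) \- (d \o t))).
Definition straighten : {linear T -> T} := cohom_ext straighten_corestr.

Lemma straighten_corestr_weight : has_weight 0 straighten_corestr.
Proof.
move=> a x xa; rewrite addr0; apply: homogD; first exact: weight0 (@proj_weight _ _ W) _ _ xa.
have tx := weight0 (@proj_weight _ _ W) xa.
have tQ := weight0 (@proj_weight _ _ W) (cQ.1 _ _ xa).
by rewrite -[a](addrK c); apply/sc/homogB => //; apply: lin_part_weight.
Qed.

Lemma straighten_corestr_inc a : straighten_corestr (inc W a) = a.
Proof. by rewrite /= Q_inc !proj_inc subrr linear0 addr0. Qed.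

Lemma straighten_cohom : cohom straighten.
Proof. exact/cohom_extP/straighten_corestr_weight. Qed.

Lemma straighten_inc a : straighten (inc W a) = inc W a.
Proof. by rewrite (cohom_inc _ straighten_cohom) proj_cohom_ext straighten_corestr_inc. Qed.

(** The chain map d s t + s t Q to the image of p. *)
Lemma straighten_acyc x : acyc (t (straighten x)) = d (s (t x)) + s (t (Q x)).
Proof.
rewrite proj_cohom_ext.
have -> : straighten_corestr x = t x + s (t (Q x) - d (t x)) by [].
rewrite (linearD acyc) acyc_s acycE (linearB s) -addrA; congr (_ + _).
by rewrite addrC subrK.
Qed.

End Straightening.

(** Both sides of the last equation become d s t Q once expressed in the old
    coordinates, by Q Q = 0 and d d = 0. *)
Lemma straightened : exists G G' : {linear T -> T}, [/\ cohom G, cancel G G', cancel G' G,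
  forall a, G (inc W a) = inc W a &
  forall x, acyc (t (G (Q (G' x)))) = d (acyc (t x))].
Proof.
have [|G' [GK G'K]] := unipotent_bij straighten_cohom.
  by move=> a; rewrite straighten_inc proj_inc.
exists straighten, G'; split=> // [|a|x]; first exact: straighten_cohom.
  exact: straighten_inc.
rewrite straighten_acyc QQ !linear0 addr0 -{2}[x]G'K straighten_acyc.
by rewrite linearD /= lin_part_sq add0r.
Qed.

Section Retraction.
Hypothesis Q_acyc : forall x, acyc (t (Q x)) = d (acyc (t x)).

Let pi0 : {linear T -> T} := tfun harm.

Lemma pi0_cohom : cohom pi0.
Proof. exact/tfun_cohom/harm_weight. Qed.

Lemma pi0_idem x : pi0 (pi0 x) = pi0 x.
Proof. by rewrite /pi0 tfun_comp; apply: eq_tfun => a; apply: harm_idem. Qed.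

(** On words in the image of 1 - p, the straightened equation makes the component of
    the corestriction in the image of p vanish, so [coder_stable] applies. *)
Lemma pi0_stable x : Q (pi0 x) = pi0 (Q (pi0 x)).
Proof.
apply: (coder_stable cQ harm_weight harm_idem) => y.
by rewrite harmE Q_acyc proj_tfun acyc_harm linear0 subr0.
Qed.

Let S : {linear T -> T} := derive (- c) s.
Let L : {linear T -> T} := (Q \o S) \+ (S \o Q).

Lemma S_coder : coder (- c) S.
Proof. exact: derive_coder sc. Qed.

Lemma S_pi0 x : S (pi0 x) = 0.
Proof.
rewrite /S /pi0; elim/concat_ind: x => [|k x y IHx IHy|a|a w _ IHw]; first by rewrite !linear0.
- by rewrite !linearP IHx IHy scaler0 addr0.
- by rewrite tfun_inc derive_inc s_harm linear0.
rewrite tfun_rapp derive_rapp IHw linear0 add0r s_harm.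
exact: (lin0 (rapp_linear _)).
Qed.

Lemma L_pi0 x : L (pi0 x) = 0.
Proof. by rewrite /L /= S_pi0 linear0 add0r pi0_stable S_pi0. Qed.

Lemma L_Q x : L (Q x) = Q (L x).
Proof. by rewrite /L /= QQ linear0 addr0 linearD /= QQ add0r. Qed.

Lemma L_coder : has_weight 0 L /\
  forall x, cop W (L x) = tmap L idfun (cop W x) + tmap idfun L (cop W x).
Proof. exact: anticomm_coder odd_c cQ S_coder. Qed.

Lemma L_inc a : L (inc W a) = inc W (acyc a).
Proof. by rewrite /L /= Q_inc !derive_inc Q_inc -linearD. Qed.

(** Both coderivations are p on letters, so their difference shortens words. *)
Lemma L_word w m : size w = m.+1 -> short m (L (word w) - derive 0 acyc (word w)).
Proof.
move=> wm; rewrite -[_ - _]/((L \- derive 0 acyc) (word w)).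
apply: (@coder_lowers _ _ _ (L \- derive 0 acyc) idfun) => [|a|].
- apply: derivationB; first exact: L_coder.2.
  exact/coder0_derivation/derive_coder/acyc_weight.
- rewrite [X in t X](_ : _ = L (inc W a) - derive 0 acyc (inc W a)) //.
  by rewrite L_inc derive_inc subrr linear0.
by apply: short_word; rewrite wm.
Qed.

(** On a word with k letters in the image of p and all others in the image of
    1 - p, L + pi0 is multiplication by max(k, 1) up to shorter words; in
    characteristic 0 this is nonzero. *)
Lemma L_pi0_bij : exists A' : {linear T -> T}, cancel (L \+ pi0) A' /\ cancel A' (L \+ pi0).
Proof.
apply: (triangular_bij acyc_idem) => w m pw wm.
pose k := count (fun a => acyc a == a) w.
exists (if k == 0%N then 1 else k%:R : K).
  have [_|k0] := eqVneq k 0%N; first exact: oner_neq0.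
  by move/pcharf0P: charK => ->.
have -> : (L \+ pi0) (word w) - (if k == 0%N then 1 else k%:R) *: word w =
   L (word w) - derive 0 acyc (word w).
  rewrite [(L \+ pi0) _]/= -/L (tfun_compl_pure pw) (derive_pure pw) -/k -addrA.
  congr (_ + _); case: (eqVneq k 0%N) => [->|k0]; first by rewrite scale0r oppr0 subrr.
  by rewrite scale0r add0r.
exact: L_word.
Qed.

(** [kerproj] for the anticommutator of Q and S. *)
Lemma splitting_projector : exists P : {linear T -> T}, [/\ cohom P,
  forall x, P (Q x) = Q (P x), forall x, pi0 (P x) = P x &
  forall a, P (inc W a) = inc W (harm a)].
Proof.
have [A' [AK A'K]] := L_pi0_bij.
have [L0 dL] := L_coder.
exists (kerproj pi0 A'); split=> [|x|x|a].
- exact: kerproj_cohom L0 dL pi0_cohom pi0_idem L_pi0 AK A'K.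
- by apply: (kerproj_comm pi0_idem L_pi0 AK A'K L_Q); apply: pi0_stable.
- exact: pi0_idem.
have := AK (inc W a); rewrite [X in A' X](_ : _ = L (inc W a) + pi0 (inc W a)) //.
rewrite L_inc [pi0 _]tfun_inc -linearD harmE /= addrC subrK /kerproj /= => ->.
exact: tfun_inc.
Qed.

(** The corestriction of F has the components (1 - p) t P and p t. The first one
    makes the composite of F with T(1 - p) equal to P, which commutes with Q;
    the second one was straightened to a chain map. *)
Lemma splitting_isomorphism : exists F F' : {linear T -> T},
  [/\ cohom F, cancel F F' /\ cancel F' F, forall a, F (inc W a) = inc W a,
   forall x, pi0 (F (Q (F' x))) = Q (pi0 x) &
   forall x, acyc (t (F (Q (F' x)))) = d (acyc (t x))].
Proof.
have [P [cP PQ pi0P P_inc]] := splitting_projector.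
pose f : {linear T -> W} := (harm \o t \o P) \+ (acyc \o t).
have fE x : f x = harm (t (P x)) + acyc (t x) by [].
have f0 : has_weight 0 f.
  move=> a x xa; rewrite addr0 fE.
  have tw := weight0 (@proj_weight _ _ W).
  apply: homogD; first exact/(weight0 harm_weight)/tw/(weight0 cP.1).
  exact/(weight0 acyc_weight)/tw.
have cF := cohom_extP f0.
set F := cohom_ext f in cF *.
have pF x : t (F x) = f x by apply: proj_cohom_ext.
have F_inc a : F (inc W a) = inc W a.
  rewrite (cohom_inc _ cF) pF fE P_inc !proj_inc harm_idem harmE.
  by rewrite subrK.
have [|F' [FK F'K]] := unipotent_bij cF; first by move=> a; rewrite F_inc proj_inc.
have pi0F x : pi0 (F x) = P x.
  move: x; apply: (@cohom_unique _ _ _ _ (pi0 \o F)) => [x|x|x].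
  - exact: (cohom_comp cF pi0_cohom).2.
  - exact: cP.2.
  rewrite /= proj_tfun pF fE (linearD harm) harm_idem harm_acyc addr0.
  by rewrite -[in RHS]pi0P proj_tfun.
have aF x : acyc (t (F x)) = acyc (t x).
  by rewrite pF fE (linearD acyc) acyc_harm acyc_idem add0r.
exists F, F'; split=> // x.
  by rewrite pi0F PQ -pi0F F'K.
by rewrite aF Q_acyc -{2}[x]F'K aF.
Qed.
End Retraction.
End Splitting.

(** * Images of idempotents, direct sums and desuspension *)

Section FixedSpace.
Variables (K : fieldType) (n : nat) (V : gradedSpace K n) (e : {linear V -> V}).

Definition fixpred : {pred V} := fun v => e v == v.

Lemma fixpred_submod : submod_closed fixpred.
Proof.
split=> [|k x y]; rewrite !unfold_in ?linear0 // => /eqP ex /eqP ey.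
by rewrite linearP ex ey.
Qed.
HB.instance Definition _ := GRing.isSubmodClosed.Build K V fixpred fixpred_submod.

Record fixed := Fixed { fixval :> V; _ : fixval \in fixpred }.
HB.instance Definition _ := [isSub for fixval].
HB.instance Definition _ := [Choice of fixed by <:].
HB.instance Definition _ := [SubChoice_isSubLmodule of fixed by <:].

Hypotheses (e0 : has_weight 0 e) (ee : forall v, e (e v) = e v).

Lemma fixedP (x : fixed) : e (val x) = val x.
Proof. by apply/eqP; case: x. Qed.

Lemma fix_mem v : e v \in fixpred.
Proof. by rewrite unfold_in ee. Qed.
Definition fixpr v : fixed := Fixed (fix_mem v).

Lemma fixpr_linear : linear fixpr.
Proof. by move=> k x y; apply: val_inj; rewrite /= !linearP. Qed.

Definition fixgpr a (x : fixed) : fixed := fixpr (gpr a (val x)).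

Lemma val_fixgpr a x : val (fixgpr a x) = gpr a (val x).
Proof. by rewrite /= (weight_gpr e0) addr0 fixedP. Qed.

Lemma fixgpr_linear a : linear (fixgpr a).
Proof. by move=> k x y; rewrite /fixgpr -fixpr_linear -gpr_linear -linearP. Qed.

Lemma fixgprK a b x : fixgpr a (fixgpr b x) = if a == b then fixgpr b x else 0.
Proof.
apply: val_inj; rewrite !val_fixgpr gprK; case: ifP => _; rewrite ?val_fixgpr //.
Qed.

Lemma fixgpr_fin x : exists s, uniq s /\ x = \sum_(a <- s) fixgpr a x.
Proof.
exists (gsupp (val x)); split; first exact: gsupp_uniq.
apply: val_inj; rewrite [RHS]raddf_sum /= {1}[fixval x]gsuppE.
by apply: eq_bigr => a _; apply/esym/val_fixgpr.
Qed.

(** The image of the idempotent e, realized as its fixed vectors. *)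
Definition idemSpace : gradedSpace K n :=
  @GradedSpace K n fixed fixgpr fixgpr_linear fixgprK fixgpr_fin.

Lemma fixinc_linear : linear (fixval : idemSpace -> V).
Proof. by move=> k x y; apply: (linearP (val : fixed -> V)). Qed.
Definition fixinc : {linear idemSpace -> V} :=
  HB.pack (fixval : idemSpace -> V) (GRing.isLinear.Build K idemSpace V _ _ fixinc_linear).
Definition fixproj : {linear V -> idemSpace} :=
  HB.pack (fixpr : V -> idemSpace) (GRing.isLinear.Build K V idemSpace _ _ fixpr_linear).

Lemma fixincK : cancel fixinc fixproj.
Proof. by move=> x; apply: val_inj; apply: fixedP. Qed.
Lemma e_fixinc x : e (fixinc x) = fixinc x.
Proof. exact: fixedP. Qed.
Lemma fixproj_e v : fixproj (e v) = fixproj v.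
Proof. by apply: val_inj; apply: ee. Qed.

Lemma fixinc_weight : has_weight 0 fixinc.
Proof.
move=> a x xa; rewrite addr0 /homog -[gpr a _](val_fixgpr a x).
by congr (val _); apply: xa.
Qed.
Lemma fixproj_weight : has_weight 0 fixproj.
Proof.
move=> a x xa; rewrite addr0; apply: val_inj; rewrite val_fixgpr.
exact: weight0 e0 _ _ xa.
Qed.
End FixedSpace.
Arguments idemSpace {K n V e} e0 ee.
Arguments fixinc {K n V e} e0 ee.
Arguments fixproj {K n V e} e0 ee.

Section DirectSumMaps.
Variables (K : fieldType) (n : nat) (V A B : gradedSpace K n).

Lemma dsum_fst_linear : linear (fst : dsum A B -> A). Proof. by []. Qed.
Definition dsum_fst : {linear dsum A B -> A} :=
  HB.pack (fst : dsum A B -> A) (GRing.isLinear.Build K (dsum A B) A _ _ dsum_fst_linear).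
Lemma dsum_snd_linear : linear (snd : dsum A B -> B). Proof. by []. Qed.
Definition dsum_snd : {linear dsum A B -> B} :=
  HB.pack (snd : dsum A B -> B) (GRing.isLinear.Build K (dsum A B) B _ _ dsum_snd_linear).

Lemma dsum_fst_weight : has_weight 0 dsum_fst.
Proof. by move=> a x xa; rewrite addr0 /homog -[in RHS]xa. Qed.
Lemma dsum_snd_weight : has_weight 0 dsum_snd.
Proof. by move=> a x xa; rewrite addr0 /homog -[in RHS]xa. Qed.

Variables (f : {linear V -> A}) (g : {linear V -> B}).
Lemma dsum_pair_linear : linear (fun v => (f v, g v) : dsum A B).
Proof. by move=> k x y; rewrite !linearP. Qed.
Definition dsum_pair : {linear V -> dsum A B} := HB.pack (fun v => (f v, g v) : dsum A B)
  (GRing.isLinear.Build K V (dsum A B) _ _ dsum_pair_linear).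
Lemma dsum_pair_weight : has_weight 0 f -> has_weight 0 g -> has_weight 0 dsum_pair.
Proof.
move=> f0 g0 a x xa; rewrite addr0 /homog; congr (_, _).
  exact: weight0 f0 _ _ xa.
exact: weight0 g0 _ _ xa.
Qed.
End DirectSumMaps.

Section Structures.
Variables (K : fieldType) (n : nat).
Implicit Types V : gradedSpace K n.+1.

Lemma desusp_weight V V' c (f : {linear V -> V'}) : has_weight c f ->
  has_weight c (f : {linear desusp V -> desusp V'}).
Proof. by move=> fc a v va; have := fc _ _ va; rewrite addrAC. Qed.

Lemma undesusp_weight V V' c (f : {linear desusp V -> desusp V'}) : has_weight c f ->
  has_weight c (f : {linear V -> V'}).
Proof.
move=> fc a v va; have : homog (V := desusp V) (a - e1 n) v.
  by rewrite /homog /= /desusp_pr subrK.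
by move=> /fc; rewrite /homog /= /desusp_pr addrAC subrK.
Qed.

Lemma downs_map V V' (f : {linear V -> V'}) v : has_weight 0 f ->
  downs (map f v) = map (f : desusp V -> desusp V') (downs v).
Proof.
move=> f0; elim: v => //= a v ->; rewrite size_map /down; congr (_ :: _).
exact: weight0_ksign.
Qed.

Lemma downs1 V (v : V) : downs [:: v] = [:: v : desusp V].
Proof. by rewrite /= /down mulr0n ksign0. Qed.

Lemma size_downs V (v : seq V) : size (downs v) = size v.
Proof. by elim: v => //= a v ->. Qed.

Lemma corestrictionE (W W' : gradedSpace K n) (F : {linear tcoalg W -> tcoalg W'}) w :
  corestriction F w = proj W' (F (word w)).
Proof. by rewrite /corestriction /proj unlock. Qed.

Lemma codifferential_conj (W W' : gradedSpace K n) c (Q : {linear tcoalg W -> tcoalg W})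
    (F : {linear tcoalg W -> tcoalg W'}) (F' : {linear tcoalg W' -> tcoalg W}) :
  cohom F -> cohom F' -> cancel F' F -> coder c Q -> (forall x, Q (Q x) = 0) ->
  (forall y, F' (F (Q (F' y))) = Q (F' y)) -> codifferential c (F \o (Q \o F')).
Proof.
move=> cF cF' FK cQ QQ st; split; first exact/coderP/coder_conj.
by move=> x /=; rewrite st QQ linear0.
Qed.
End Structures.

(** * The minimal and the contractible summand *)

(** In this section h and p are the projections of W onto the part with zero
    differential and onto the acyclic part, Q is a codifferential for which
    T(h) is stable, and D is Q in the coordinates that split it. *)
Section Assembly.
Variables (K : fieldType) (n : nat) (V : gradedSpace K n.+1).
Local Notation W := (desusp V).
Local Notation T := (tcoalg W).
Variables (h p d s : {linear V -> V}).
Hypotheses (h0 : has_weight 0 h) (p0 : has_weight 0 p).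
Hypotheses (hh : forall v, h (h v) = h v) (pp : forall v, p (p v) = p v).
Hypotheses (hp : forall v, h (p v) = 0) (ph : forall v, p (h v) = 0).
Hypotheses (hDp : forall v, h v + p v = v).
Hypotheses (dh : forall v, d (h v) = 0) (pd : forall v, p (d v) = d v).
Hypotheses (ps : forall v, p (s v) = s v) (pE : forall v, p v = d (s v) + s (d v)).

Let hW : {linear W -> W} := h.
Let pW : {linear W -> W} := p.

Variables Q D : {linear T -> T}.
Hypotheses (cQ : coder (e1 n) Q) (QQ : forall x, Q (Q x) = 0).
Hypotheses (cD : coder (e1 n) D) (DD : forall x, D (D x) = 0).
Hypothesis Q_inc : forall a, Q (inc W a) = inc W (d a).
Hypothesis Q_stable : forall x, Q (tfun hW x) = tfun hW (Q (tfun hW x)).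
Hypothesis D_h : forall x, tfun hW (D x) = Q (tfun hW x).
Hypothesis D_p : forall x, pW (proj W (D x)) = d (p (proj W x)).

Let M := idemSpace h0 hh.
Let C := idemSpace p0 pp.
Let iM : {linear desusp M -> W} := fixinc h0 hh.
Let rM : {linear W -> desusp M} := fixproj h0 hh.
Let iC : {linear desusp C -> W} := fixinc p0 pp.
Let rC : {linear W -> desusp C} := fixproj p0 pp.

Let iM0 : has_weight 0 iM. Proof. exact/desusp_weight/fixinc_weight. Qed.
Let rM0 : has_weight 0 rM. Proof. exact/desusp_weight/fixproj_weight. Qed.
Let iC0 : has_weight 0 iC. Proof. exact/desusp_weight/fixinc_weight. Qed.
Let rC0 : has_weight 0 rC. Proof. exact/desusp_weight/fixproj_weight. Qed.

Let rMK v : iM (rM v) = h v. Proof. by []. Qed.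
Let rCK v : iC (rC v) = p v. Proof. by []. Qed.
Let iMK v : rM (iM v) = v. Proof. exact: fixincK. Qed.
Let iCK v : rC (iC v) = v. Proof. exact: fixincK. Qed.

Lemma tfunK (A B : gradedSpace K n.+1) (f : {linear A -> B}) (g : {linear B -> A}) :
  (forall a, g (f a) = a) -> cancel (tfun f) (tfun g).
Proof. by move=> fK x; rewrite tfun_comp; apply: tfun_id. Qed.

Lemma codifferential_restrict (A : gradedSpace K n.+1) (f : {linear A -> W})
    (g : {linear W -> A}) (E : {linear T -> T}) (e : {linear W -> W}) :
  has_weight 0 f -> has_weight 0 g -> (forall a, g (f a) = a) -> (forall v, f (g v) = e v) ->
  coder (e1 n) E -> (forall x, E (E x) = 0) ->
  (forall x, E (tfun e x) = tfun e (E (tfun e x))) ->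
  codifferential (e1 n) (tfun g \o (E \o tfun f)).
Proof.
move=> f0 g0 fK gf cE EE Ee; apply: codifferential_conj => // [||x|x].
- exact: tfun_cohom.
- exact: tfun_cohom.
- exact: tfunK.
have <- : tfun e (tfun f x) = tfun f x.
  by rewrite tfun_comp; apply: eq_tfun => a /=; rewrite -gf fK.
have fg y : tfun f (tfun g y) = tfun e y by rewrite tfun_comp; apply: eq_tfun.
by rewrite fg -Ee.
Qed.

Let pW0 : has_weight 0 pW. Proof. exact: desusp_weight. Qed.

Lemma proj_D x : proj W (D x) = proj W (Q (tfun hW x)) + d (p (proj W x)).
Proof. by rewrite -D_p -D_h proj_tfun; apply/esym/hDp. Qed.

Lemma D_stable x : D (tfun pW x) = tfun pW (D (tfun pW x)).
Proof.
apply: (coder_stable cD pW0 pp) => {}x; rewrite D_p proj_tfun pp proj_D.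
rewrite tfun_comp proj_tfun pp.
have -> : tfun (hW \o pW) x = tfun (\0 : {linear W -> W}) x by apply: eq_tfun => a; apply: hp.
have -> : tfun (\0 : {linear W -> W}) x = 0.
  elim/word_ind: x => [|k x y IHx IHy|[|a w]]; first by rewrite linear0.
  - by rewrite linearP IHx IHy scaler0 addr0.
  - by rewrite word_nil linear0.
  by rewrite tfunE word_zero //= mem_head.
by rewrite !linear0 add0r.
Qed.

Definition QM : lodInf M := LodInf (codifferential_restrict iM0 rM0 iMK rMK cQ QQ Q_stable).
Definition QC : lodInf C := LodInf (codifferential_restrict iC0 rC0 iCK rCK cD DD D_stable).

Let S := dsum M C.
Let phi : {linear W -> desusp S} := dsum_pair (fixproj h0 hh) (fixproj p0 pp).
Let psi : {linear desusp S -> W} :=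
  (fixinc h0 hh \o dsum_fst M C) \+ (fixinc p0 pp \o dsum_snd M C).

Let phi0 : has_weight 0 phi.
Proof. by apply/desusp_weight/dsum_pair_weight; apply: fixproj_weight. Qed.

Let psi0 : has_weight 0 psi.
Proof.
have F : has_weight 0 (fixinc h0 hh \o dsum_fst M C).
  by apply: weight_comp0; [apply: dsum_fst_weight|apply: fixinc_weight].
have F' : has_weight 0 (fixinc p0 pp \o dsum_snd M C).
  by apply: weight_comp0; [apply: dsum_snd_weight|apply: fixinc_weight].
by apply: desusp_weight => a x xa; apply: homogD; [apply: F|apply: F'].
Qed.

Let psiE x : psi x = iM x.1 + iC x.2. Proof. by []. Qed.
Let phiE v : phi v = (rM v, rC v). Proof. by []. Qed.
Let h_iM x : h (iM x) = iM x. Proof. exact: e_fixinc. Qed.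
Let p_iC x : p (iC x) = iC x. Proof. exact: e_fixinc. Qed.

Let phiK v : psi (phi v) = v. Proof. exact: hDp. Qed.
Let h_psi x : h (psi x) = iM x.1.
Proof. by rewrite psiE (linearD h) h_iM -p_iC hp addr0. Qed.
Let p_psi x : p (psi x) = iC x.2.
Proof. by rewrite psiE (linearD p) p_iC -h_iM ph add0r. Qed.
Let psiK x : phi (psi x) = x.
Proof.
rewrite phiE [RHS]surjective_pairing; congr (_, _).
  by rewrite -[RHS]iMK -h_psi; apply/esym/fixproj_e.
by rewrite -[RHS]iCK -p_psi; apply/esym/fixproj_e.
Qed.

Lemma QD_codiff : codifferential (e1 n) (tfun phi \o (D \o tfun psi)).
Proof.
apply: (codifferential_restrict (e := idfun) psi0 phi0 psiK phiK cD DD) => x.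
by rewrite !(tfun_id (e := idfun)).
Qed.
Definition QD : lodInf S := LodInf QD_codiff.

Lemma lod_pi_QM v : lod_pi QM v = rM (proj W (Q (tfun iM (word (downs v))))).
Proof. by rewrite -proj_tfun; apply: corestrictionE. Qed.

Lemma lod_pi_QC v : lod_pi QC v = rC (d (iC (letter (downs v)))).
Proof.
have -> : lod_pi QC v = rC (proj W (D (tfun iC (word (downs v))))).
  by rewrite -proj_tfun; apply: corestrictionE.
by rewrite -[LHS]fixproj_e D_p proj_tfun projE p_iC.
Qed.

Lemma lod_pi_QD v : lod_pi QD v = phi (proj W (D (tfun psi (word (downs v))))).
Proof. by rewrite -proj_tfun; apply: corestrictionE. Qed.

Lemma QM_minimal : minimal QM.
Proof.
move=> v; rewrite lod_pi_QM downs1 -incE tfun_inc Q_inc proj_inc.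
by rewrite -[iM v]h_iM dh linear0.
Qed.

Lemma QC_contractible : contractible QC.
Proof.
split=> [v v1|v].
  have := size_downs v; rewrite lod_pi_QC; case: (downs v) => [|a [|b w]] vs.
  - by rewrite -vs in v1.
  - by rewrite -vs in v1.
  by rewrite !linear0.
rewrite lod_pi_QC downs1 => /(congr1 iC); rewrite rCK linear0 pd => dv.
exists (rC (s (iC v))); rewrite lod_pi_QC downs1 rCK ps.
by rewrite -[LHS]iCK -{1}p_iC pE dv linear0 addr0.
Qed.

Lemma downs_fst (v : seq S) :
  map (fst : desusp S -> desusp M) (downs v) = downs (V := M) (map fst v).
Proof. exact/esym/(downs_map v (@dsum_fst_weight _ _ M C)). Qed.
Lemma downs_snd (v : seq S) :
  map (snd : desusp S -> desusp C) (downs v) = downs (V := C) (map snd v).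
Proof. exact/esym/(downs_map v (@dsum_snd_weight _ _ M C)). Qed.

Lemma QD_direct_sum : is_direct_sum QM QC QD.
Proof.
move=> v; rewrite lod_pi_QC lod_pi_QM lod_pi_QD phiE; congr (_, _).
  have rh x : rM (proj W x) = rM (proj W (tfun hW x)).
    by rewrite proj_tfun; apply/esym/fixproj_e.
  rewrite rh D_h; congr (rM (proj W (Q _))).
  rewrite tfun_comp !tfunE -downs_fst -map_comp; congr word.
  by apply: eq_map => x; apply: h_psi.
rewrite -[LHS]fixproj_e D_p proj_tfun p_psi; congr (rC (d (iC _))).
by rewrite projE -downs_snd; case: (downs v) => [|x [|y w]].
Qed.

Lemma QD_isomorphic (Q0 : lodInf V) (F : {linear T -> T}) : cohom F ->
  (forall x, D (F x) = F (Q0 x)) -> (forall a, F (inc W a) = inc W a) ->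
  lod_isomorphic Q0 QD.
Proof.
move=> cF DF F_inc; pose F1 : {linear T -> tcoalg (desusp S)} := tfun phi \o F.
have cF1 : cohomomorphism F1.
  by apply/cohomP; apply: cohom_comp cF _; apply: tfun_cohom.
have F1_comm x : QD (F1 x) = F1 (Q0 x).
  by rewrite /= (tfunK phiK) DF.
have F1_inc (v : V) : lod_f (LodMorphism cF1 F1_comm) [:: v] = phi v.
  rewrite /lod_f corestrictionE downs1 -incE.
  have -> : LodMorphism cF1 F1_comm (inc W v) = tfun phi (F (inc W v)) by [].
  by rewrite F_inc tfun_inc proj_inc.
by exists (LodMorphism cF1 F1_comm); exists psi => v; rewrite F1_inc.
Qed.
End Assembly.

Theorem theorem6 (K : fieldType) (charK0 : [pchar K]%R =i pred0) (n : nat)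
    (V : gradedSpace K n.+1) (Q : lodInf V) :
  exists (M : gradedSpace K n.+1) (QM : lodInf M)
         (C : gradedSpace K n.+1) (QC : lodInf C)
         (D : lodInf (dsum M C)),
    minimal QM /\ contractible QC /\ is_direct_sum QM QC D /\
    lod_isomorphic Q D.
Proof.
have /= [/coderP cQ QQ] := lodQP Q.
pose W := desusp V; pose t := proj W.
have odd : ksgn K (dotp (e1 n) (e1 n)) = - 1.
  suff -> : dotp (e1 n) (e1 n) = 1 by rewrite /ksgn expr1z.
  rewrite /dotp (bigD1 0) //= big1 ?addr0 => [|i i0]; rewrite !mxE !eqxx //=.
  by rewrite (negPf i0) mul0r.
pose d : {linear W -> W} := t \o Q \o inc W.
have Q_inc a : Q (inc W a) = inc W (d a).
  by rewrite {1}[Q _]reconstruct cQ.2 cop_inc !linear0 addr0 !linear0 addr0.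
have dd := lin_part_sq QQ Q_inc.
have d1 := lin_part_weight cQ Q_inc.
have [s [s1 dsd sds ss]] := homotopy d1 dd.
have [G [G' [cG GK G'K G_inc acycG]]] := straightened cQ QQ Q_inc s1 sds ss.
have cG' := cohom_inv GK G'K cG.
(* Q1 is the straightened structure, D the split one. *)
pose Q1 : {linear tcoalg W -> tcoalg W} := G \o (Q \o G').
have cQ1 : coder (e1 n) Q1 := coder_conj cG cG' G'K cQ.
have QQ1 x : Q1 (Q1 x) = 0 by rewrite /Q1 /= GK QQ linear0.
have Q1_inc a : Q1 (inc W a) = inc W (d a).
  have G'_inc : G' (inc W a) = inc W a by rewrite -{2}(GK (inc W a)) G_inc.
  by rewrite [LHS]/= G'_inc Q_inc G_inc.
have [F [F' [cF [FK F'K] F_inc hF pF]]] :=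
  splitting_isomorphism charK0 odd cQ1 QQ1 Q1_inc s1 dsd sds ss acycG.
have cF' := cohom_inv FK F'K cF.
pose D : {linear tcoalg W -> tcoalg W} := F \o (Q1 \o F').
have cD : coder (e1 n) D := coder_conj cF cF' F'K cQ1.
have DE y : D y = F (Q1 (F' y)) by [].
have DD x : D (D x) = 0 by rewrite !DE FK QQ1 linear0.
pose p : {linear W -> W} := acyc d s; pose h : {linear W -> W} := harm d s.
have h0 : has_weight 0 (h : {linear V -> V}) := undesusp_weight (harm_weight cQ Q_inc s1).
have p0 : has_weight 0 (p : {linear V -> V}) := undesusp_weight (acyc_weight cQ Q_inc s1).
have hh := harm_idem QQ Q_inc dsd sds ss.
have pp := acyc_idem QQ Q_inc dsd sds ss.
have hp := harm_acyc QQ Q_inc dsd sds ss.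
have ph := acyc_harm QQ Q_inc dsd sds ss.
have hDp v : h v + p v = v by rewrite /h harmE subrK.
have dh := d_harm QQ Q_inc dsd.
have pd := acyc_d QQ Q_inc dsd.
have ps := acyc_s sds ss.
have h_stable := pi0_stable cQ1 QQ1 Q1_inc s1 dsd sds ss acycG.
have FQ x : D (F (G x)) = F (G (Q x)) by rewrite DE FK /Q1 [LHS]/= GK.
have FG_inc a : F (G (inc W a)) = inc W a by rewrite G_inc F_inc.
pose M := idemSpace h0 hh; pose C := idemSpace p0 pp.
pose QM' := QM h0 hh cQ1 QQ1 h_stable; pose QC' := QC p0 pp hp hDp cD DD hF pF.
pose D' := QD h0 p0 hh pp hp ph hDp cD DD.
exists M, QM', C, QC', D'; split; first exact: (QM_minimal (h0:=h0) (hh:=hh) dh cQ1 QQ1 Q1_inc h_stable).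
split; first exact: (QC_contractible p0 pp hp hDp pd ps (fun=> erefl) cD DD hF pF).
split; first exact: (QD_direct_sum (h0:=h0) (p0:=p0) (hh:=hh) (pp:=pp) hp ph hDp cQ1 QQ1 cD DD h_stable hF pF).
exact: QD_isomorphic (cohom_comp cG cF) FQ FG_inc.
Qed.
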